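(* Consider the hardware-impaired uplink model described in the context, with arbitrary pilot sequences $\tilde{\mathbf{x}}_{lk}\in\mathbb{C}^B$. Let $\boldsymbol{\psi}_j=[\mathbf{y}_j^{T}(1)\,\ldots\,\mathbf{y}_j^{T}(B)]^{T}\in\mathbb{C}^{NB}$ be the received signal at BS $j$ from the pilot transmission. For every $j,l,k$ and every channel use $t\ge B$, the LMMSE estimate (linear minimum mean square error estimate based on $\boldsymbol{\psi}_j$) of the effective channel $\mathbf{h}_{jlk}(t)=\mathbf{D}_{\boldsymbol{\phi}_j(t)}\mathbf{h}_{jlk}$ is $$\hat{\mathbf{h}}_{jlk}(t)=\left(\lambda_{jlk}\,\tilde{\mathbf{x}}_{lk}^{H}\mathbf{D}_{\boldsymbol{\delta}(t)}\boldsymbol{\Psi}_j^{-1}\otimes\mathbf{I}_N\right)\boldsymbol{\psi}_j,$$ where $\otimes$ is the Kronecker product, $\mathbf{D}_{\boldsymbol{\delta}(t)}=\mathrm{diag}\big(e^{-\frac{\delta}{2}(t-1)},e^{-\frac{\delta}{2}(t-2)},\ldots,e^{-\frac{\delta}{2}(t-B)}\big)$, $$\boldsymbol{\Psi}_j=\sum_{\ell=1}^{L}\sum_{m=1}^{K}\lambda_{j\ell m}\mathbf{X}_{\ell m}+\sigma^2\xi\,\mathbf{I}_B,$$ and $\mathbf{X}_{\ell m}\in\mathbb{C}^{B\times B}$ has entries $$[\mathbf{X}_{\ell m}]_{i_1,i_2}=\begin{cases}|x_{\ell m}(i_1)|^2(1+\kappa^2), & i_1=i_2,\\ x_{\ell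 m}(i_1)\,x_{\ell m}^*(i_2)\,e^{-\frac{\delta}{2}|i_1-i_2|}, & i_1\neq i_2.\end{cases}$$ The corresponding error covariance matrix is $$\mathbf{C}_{jlk}=\mathbb{E}\left\{(\mathbf{h}_{jlk}(t)-\hat{\mathbf{h}}_{jlk}(t))(\mathbf{h}_{jlk}(t)-\hat{\mathbf{h}}_{jlk}(t))^{H}\right\}=\lambda_{jlk}\left(1-\lambda_{jlk}\tilde{\mathbf{x}}_{lk}^{H}\mathbf{D}_{\boldsymbol{\delta}(t)}\boldsymbol{\Psi}_j^{-1}\mathbf{D}_{\boldsymbol{\delta}(t)}^{H}\tilde{\mathbf{x}}_{lk}\right)\mathbf{I}_N,$$ and the mean-squared error is $\mathrm{MSE}_{jlk}=\mathrm{tr}(\mathbf{C}_{jlk})$.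
   Context: Model. There are $L\ge1$ cells, each with one base station (BS) having $N$ antennas and $K$ single-antenna users (UEs). A coherence block has $T$ channel uses $t\in\{1,\ldots,T\}$, the first $B\ge K$ of which are used for pilots. The channel from UE $k$ in cell $l$ to BS $j$ is $\mathbf{h}_{jlk}=[h_{jlk}^{(1)}\ldots h_{jlk}^{(N)}]^T\sim\mathcal{CN}(\mathbf{0},\lambda_{jlk}\mathbf{I}_N)$ with $\lambda_{jlk}>0$ (circularly symmetric complex Gaussian), constant over the block; different channels are independent. Write $\mathbf{H}_{jl}=[\mathbf{h}_{jl1}\ldots\mathbf{h}_{jlK}]$. The signal received by BS $j$ at channel use $t$ is $$\mathbf{y}_j(t)=\mathbf{D}_{\boldsymbol{\phi}_j(t)}\sum_{l=1}^{L}\mathbf{H}_{jl}\mathbf{x}_l(t)+\boldsymbol{\upsilon}_j(t)+\boldsymbol{\eta}_j(t),$$ where $\mathbf{x}_l(t)=[x_{l1}(t)\ldots x_{lK}(t)]^T$ are the transmit signals, with $\mathbb{E}\{|x_{lk}(t)|^2\}\le p_{lk}$. (1) Phase drift: $\mathbf{D}_{\boldsymbol{\phi}_j(t)}=\mathrm{diag}(e^{\imath\phi_{j1}(t)},\ldots,e^{\imath\phi_{jN}(t)})$, where $\imath$ is the imaginary unit and each $\phi_{jn}$ is a discrete-time Wiener process: $\phi_{jn}(t)$ equals $\phi_{jn}(t-1)$ plus an independent $\mathcal{N}(0,\delta)$ innovation, $\delta\ge0$; the processes are independent across antennas. (2) Distortion noise: conditionally on the channels, $\boldsymbol{\upsilon}_j(t)\sim\mathcal{CN}(\mathbf{0},\boldsymbol{\Upsilon}_j(t))$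 with $\boldsymbol{\Upsilon}_j(t)=\kappa^2\sum_{l=1}^{L}\sum_{k=1}^{K}\mathbb{E}\{|x_{lk}(t)|^2\}\,\mathrm{diag}(|h_{jlk}^{(1)}|^2,\ldots,|h_{jlk}^{(N)}|^2)$, $\kappa\ge0$, independent between antennas and channel uses. (3) Receiver noise: $\boldsymbol{\eta}_j(t)\sim\mathcal{CN}(\mathbf{0},\sigma^2\xi\mathbf{I}_N)$ with $\sigma^2>0$, $\xi\ge1$, independent over time. Channels, phase-drift processes and receiver noise are mutually independent, and given the channels the distortion noise is independent of the phase drifts and receiver noise. Pilots: for $t=1,\ldots,B$ the symbols $x_{lk}(t)$ are deterministic (so $\mathbb{E}\{|x_{lk}(t)|^2\}=|x_{lk}(t)|^2$), and $\tilde{\mathbf{x}}_{lk}=[x_{lk}(1)\ldots x_{lk}(B)]^T\in\mathbb{C}^B$ is the pilot sequence of UE $k$ in cell $l$, arbitrary subject to the power constraint. The LMMSE estimate of a zero-mean vector $\mathbf{h}$ from a zero-mean observation $\boldsymbol{\psi}$ is the linear function $\mathbf{A}\boldsymbol{\psi}$ of $\boldsymbol{\psi}$ minimizing $\mathbb{E}\{\|\mathbf{h}-\mathbf{A}\boldsymbol{\psi}\|^2\}$. $(\cdot)^H$ denotes conjugate transpose and $(\cdot)^*$ complex conjugation. *)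

(* Defs.v *)
From HB Require Import structures.
From mathcomp Require Import all_boot all_order all_algebra.
From mathcomp Require Import all_classical all_reals all_analysis.
From mathcomp.real_closed Require Export complex mxtens.

Set Implicit Arguments.
Unset Strict Implicit.
Unset Printing Implicit Defensive.

Import Order.TTheory GRing.Theory Num.Theory.
Local Open Scope classical_set_scope.
Local Open Scope ring_scope.
Local Open Scope complex_scope.

Section ComplexVectors.
Context {R : realType}.

Definition abs2 (z : R[i]) : R := complex.Re z ^+ 2 + complex.Im z ^+ 2.

Definition expi (a : R) : R[i] := cos a +i* sin a.

Definition ctransmx m n (A : 'M[R[i]]_(m, n)) : 'M[R[i]]_(n, m) :=
  (map_mx conjc A)^T.

End ComplexVectors.

Section Probability.
Context {R : realType} {d : measure_display} {Om : measurableType d}.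
Variable P : probability Om R.
Implicit Types (S E F G : set Om).

Definition measurable_crv (z : Om -> R[i]) : Prop :=
  measurable_fun setT (fun w => complex.Re (z w)) /\
  measurable_fun setT (fun w => complex.Im (z w)).

(* sigma-algebra generated by the real random variables X i, i in D *)
Definition sigma_real (I : Type) (D : set I) (X : I -> Om -> R)
  : set (set Om) :=
  <<s \bigcup_(i in D) preimage_set_system setT (X i) measurable >>.

Definition sigma_cplx (I : Type) (Z : I -> Om -> R[i]) : set (set Om) :=
  sigma_real [set: I * bool] (fun q w =>
    if q.2 then complex.Im (Z q.1 w) else complex.Re (Z q.1 w)).

(* Since each A i is a sigma-algebra, hence contains setT, the product rule
   over the whole (finite) index type yields it for every subfamily. *)
Definition mutually_independent (I : finType) (A : I -> set (set Om)) : Prop :=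
  forall E : I -> set Om, (forall i, A i (E i)) ->
    fine (P (\bigcap_(i in [set: I]) E i)) = \prod_i fine (P (E i)).

Definition independent2 (A1 A2 : set (set Om)) : Prop :=
  forall E1 E2, A1 E1 -> A2 E2 -> P (E1 `&` E2) = (P E1 * P E2)%E.

Definition independent3 (A1 A2 A3 : set (set Om)) : Prop :=
  forall E1 E2 E3, A1 E1 -> A2 E2 -> A3 E3 ->
    P (E1 `&` E2 `&` E3) = (P E1 * P E2 * P E3)%E.

(* f is a version of the conditional probability P(E | A), A a sigma-algebra *)
Definition cond_prob (A : set (set Om)) (E : set Om) (f : Om -> R) : Prop :=
  [/\ forall U : set R, measurable U -> A (f @^-1` U),
      P.-integrable setT (fun w => (f w)%:E) &
      forall G, A G -> P (G `&` E) = (\int[P]_(w in G) (f w)%:E)%E].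

Definition cond_independent (A A1 A2 : set (set Om)) : Prop :=
  forall E1 E2 f1 f2, A1 E1 -> A2 E2 ->
    cond_prob A E1 f1 -> cond_prob A E2 f2 ->
    cond_prob A (E1 `&` E2) (fun w => f1 w * f2 w).

(* The law N(0, v). The library's normal_prob takes the standard deviation and
   is not a point mass when it is 0, hence the separate case v = 0. *)
Definition centered_normal (v : R) (U : set R) : \bar R :=
  if v == 0 then \d_(0 : R) U else normal_prob 0 (Num.sqrt v) U.

Definition rect_event (I : finType) (Z : I -> Om -> R[i]) (U V : I -> set R)
  : set Om :=
  [set w | forall i, U i (complex.Re (Z i w)) /\ V i (complex.Im (Z i w))].

(* Mass given by CN(0, diag(v)) to the product of the U i + 'i V i: the
   coordinates are independent, and the real and imaginary parts of the
   i-th one are independent with law N(0, v i / 2). *)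
Definition CN_mass (I : finType) (v : I -> R) (U V : I -> set R) : R :=
  \prod_i (fine (centered_normal (v i / 2) (U i)) *
           fine (centered_normal (v i / 2) (V i))).

Definition CN_law (I : finType) (Z : I -> Om -> R[i]) (v : I -> R) : Prop :=
  forall U V : I -> set R,
    (forall i, measurable (U i)) -> (forall i, measurable (V i)) ->
    P (rect_event Z U V) = (CN_mass v U V)%:E.

Definition cond_CN_law (A : set (set Om)) (I : finType)
    (Z : I -> Om -> R[i]) (v : I -> Om -> R) : Prop :=
  forall U V : I -> set R,
    (forall i, measurable (U i)) -> (forall i, measurable (V i)) ->
    cond_prob A (rect_event Z U V) (fun w => CN_mass (v ^~ w) U V).

(* Wiener process on {1, ..., T} with innovation variance delta; the initial
   value X 1 is arbitrary. *)
Definition wiener (T : nat) (delta : R) (X : nat -> Om -> R) : Prop :=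
  (forall t, (1 <= t <= T)%N -> measurable_fun setT (X t)) /\
  forall t, (1 <= t < T)%N ->
    (forall U : set R, measurable U ->
      P [set w | U (X t.+1 w - X t w)] = centered_normal delta U) /\
    independent2 (sigma_real [set s | (1 <= s <= t)%N] X)
                 (sigma_real [set: unit] (fun _ w => X t.+1 w - X t w)).

Definition cintegrable (z : Om -> R[i]) : Prop :=
  P.-integrable setT (fun w => (complex.Re (z w))%:E) /\
  P.-integrable setT (fun w => (complex.Im (z w))%:E).

Definition cexpect (z : Om -> R[i]) : R[i] :=
  fine 'E_P[fun w => complex.Re (z w)] +i* fine 'E_P[fun w => complex.Im (z w)].

Definition mx_integrable m n (Z : Om -> 'M[R[i]]_(m, n)) : Prop :=
  forall a b, cintegrable (fun w => Z w a b).

Definition mx_expect m n (Z : Om -> 'M[R[i]]_(m, n)) : 'M[R[i]]_(m, n) :=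
  \matrix_(a, b) cexpect (fun w => Z w a b).

Definition zero_mean m (z : Om -> 'cV[R[i]]_m) : Prop :=
  mx_integrable z /\ mx_expect z = 0.

Definition mse m (g ghat : Om -> 'cV[R[i]]_m) : \bar R :=
  'E_P[fun w => \sum_(a < m) abs2 ((g w - ghat w) a 0)].

(* Valued in \bar R, so that non-integrable errors count as +oo. *)
Definition is_LMMSE m q (g : Om -> 'cV[R[i]]_m) (psi : Om -> 'cV[R[i]]_q)
    (ghat : Om -> 'cV[R[i]]_m) : Prop :=
  [/\ zero_mean g, zero_mean psi &
    exists2 A : 'M[R[i]]_(m, q), ghat = (fun w => A *m psi w) &
      forall A' : 'M[R[i]]_(m, q),
        (mse g ghat <= mse g (fun w => A' *m psi w))%E].

Definition error_outer m (g ghat : Om -> 'cV[R[i]]_m) (w : Om) : 'M[R[i]]_m :=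
  (g w - ghat w) *m ctransmx (g w - ghat w).

End Probability.

(* Data of the uplink. Channel uses are numbered from 1: 'I_B indexes the pilot
   channel uses, i : 'I_B standing for channel use i.+1, whereas phase takes
   the channel use itself. Distortion and receiver noise are only needed
   during the pilot phase. *)
Record uplink (R : realType) (Om : Type) (L N K B : nat) := Uplink {
  lambda : 'I_L -> 'I_L -> 'I_K -> R;
  power : 'I_L -> 'I_K -> R;
  pilot : 'I_L -> 'I_K -> 'cV[R[i]]_B;
  delta : R;
  kappa : R;
  sigma : R;
  xi : R;
  chan : 'I_L -> 'I_L -> 'I_K -> Om -> 'cV[R[i]]_N;
  phase : 'I_L -> 'I_N -> nat -> Om -> R;
  distortion : 'I_L -> 'I_B -> Om -> 'cV[R[i]]_N;
  rnoise : 'I_L -> 'I_B -> Om -> 'cV[R[i]]_N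
}.

Section Model.
Context {R : realType} {d : measure_display} {Om : measurableType d}.
Context {L N K B : nat}.
Variables (P : probability Om R) (T : nat) (S : uplink R Om L N K B).

Definition distortion_var (j : 'I_L) (i : 'I_B) (n : 'I_N) (w : Om) : R :=
  kappa S ^+ 2 * \sum_(l < L) \sum_(k < K)
    abs2 (pilot S l k i 0) * abs2 (chan S j l k w n 0).

Definition phase_mx (j : 'I_L) (t : nat) (w : Om) : 'M[R[i]]_N :=
  diag_mx (\row_n expi (phase S j n t w)).

Definition chan_mx (j l : 'I_L) (w : Om) : 'M[R[i]]_(N, K) :=
  \matrix_(n, k) chan S j l k w n 0.

Definition pilot_symbols (l : 'I_L) (i : 'I_B) : 'cV[R[i]]_K :=
  \col_k pilot S l k i 0.

Definition received (j : 'I_L) (i : 'I_B) (w : Om) : 'cV[R[i]]_N :=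
  phase_mx j i.+1 w *m (\sum_(l < L) chan_mx j l w *m pilot_symbols l i)
  + distortion S j i w + rnoise S j i w.

(* psi_j, the stacking of y_j(1), ..., y_j(B): mxtens_unindex a is
   (a %/ N, a %% N), the indexing used by the Kronecker product. *)
Definition pilot_obs (j : 'I_L) (w : Om) : 'cV[R[i]]_(B * N) :=
  \col_a received j (mxtens_unindex a).1 w (mxtens_unindex a).2 0.

Definition eff_chan (j l : 'I_L) (k : 'I_K) (t : nat) (w : Om)
  : 'cV[R[i]]_N :=
  phase_mx j t w *m chan S j l k w.

Definition sigma_chan : set (set Om) :=
  sigma_cplx (fun (q : 'I_L * 'I_L * 'I_K * 'I_N) w =>
    chan S q.1.1.1 q.1.1.2 q.1.2 w q.2 0).

Definition sigma_phase : set (set Om) :=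
  sigma_real [set q : 'I_L * 'I_N * nat | (1 <= q.2 <= T)%N]
    (fun q w => phase S q.1.1 q.1.2 q.2 w).

Definition sigma_rnoise : set (set Om) :=
  sigma_cplx (fun (q : 'I_L * 'I_B * 'I_N) w => rnoise S q.1.1 q.1.2 w q.2 0).

Definition sigma_distortion : set (set Om) :=
  sigma_cplx (fun (q : 'I_L * 'I_B * 'I_N) w =>
    distortion S q.1.1 q.1.2 w q.2 0).

Record uplink_model : Prop := {
  lambda_gt0 : forall j l k, 0 < lambda S j l k;
  delta_ge0 : 0 <= delta S;
  kappa_ge0 : 0 <= kappa S;
  sigma2_gt0 : 0 < sigma S ^+ 2;
  xi_ge1 : 1 <= xi S;
  pilot_power : forall l k i, abs2 (pilot S l k i 0) <= power S l k;
  chan_measurable : forall j l k n,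
    measurable_crv (fun w => chan S j l k w n 0);
  chan_law : forall j l k,
    CN_law P (fun n w => chan S j l k w n 0) (fun=> lambda S j l k);
  chan_indep : mutually_independent P (fun q : 'I_L * 'I_L * 'I_K =>
    sigma_cplx (fun n w => chan S q.1.1 q.1.2 q.2 w n 0));
  phase_wiener : forall j n, wiener P T (delta S) (phase S j n);
  phase_indep : forall j, mutually_independent P (fun n : 'I_N =>
    sigma_real [set t | (1 <= t <= T)%N] (phase S j n));
  distortion_measurable : forall j i n,
    measurable_crv (fun w => distortion S j i w n 0);
  (* one joint conditional law per base station: this contains the conditional
     independence between antennas and channel uses *)
  distortion_law : forall j,
    cond_CN_law P sigma_chan
      (fun (q : 'I_B * 'I_N) w => distortion S j q.1 w q.2 0)
      (fun q w => distortion_var j q.1 q.2 w);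
  rnoise_measurable : forall j i n,
    measurable_crv (fun w => rnoise S j i w n 0);
  rnoise_law : forall j i,
    CN_law P (fun n w => rnoise S j i w n 0) (fun=> sigma S ^+ 2 * xi S);
  rnoise_indep : forall j, mutually_independent P (fun i : 'I_B =>
    sigma_cplx (fun n w => rnoise S j i w n 0));
  sources_indep : independent3 P sigma_chan sigma_phase sigma_rnoise;
  distortion_cond_indep :
    cond_independent P sigma_chan sigma_distortion
      <<s sigma_phase `|` sigma_rnoise >>
}.

Definition D_delta (t : nat) : 'M[R[i]]_B :=
  diag_mx (\row_(i < B) (expR (- (delta S / 2) * (t%:R - i.+1%:R)))%:C).

Definition X_mx (l : 'I_L) (m : 'I_K) : 'M[R[i]]_B :=
  \matrix_(i1, i2)
    if i1 == i2 then (abs2 (pilot S l m i1 0) * (1 + kappa S ^+ 2))%:C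
    else pilot S l m i1 0 * conjc (pilot S l m i2 0) *
         (expR (- (delta S / 2) * `|i1%:R - i2%:R|))%:C.

Definition Psi_mx (j : 'I_L) : 'M[R[i]]_B :=
  \sum_(l < L) \sum_(m < K) (lambda S j l m)%:C *: X_mx l m
  + (sigma S ^+ 2 * xi S)%:C%:M.

(* castmx only identifies the row dimension 1 * N with N *)
Definition LMMSE_filter (j l : 'I_L) (k : 'I_K) (t : nat)
  : 'M[R[i]]_(N, B * N) :=
  castmx (mul1n N, erefl (B * N)%N)
    (((lambda S j l k)%:C *:
        (ctransmx (pilot S l k) *m D_delta t *m invmx (Psi_mx j)))
     *t (1%:M : 'M[R[i]]_N)).

Definition error_cov (j l : 'I_L) (k : 'I_K) (t : nat) : 'M[R[i]]_N :=
  ((lambda S j l k)%:C *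
    (1 - (lambda S j l k)%:C *
         (ctransmx (pilot S l k) *m D_delta t *m invmx (Psi_mx j)
            *m ctransmx (D_delta t) *m pilot S l k) 0 0))%:M.

End Model.

(* Main.v *)
(* The LMMSE estimator is determined by orthogonality: if e = h - A psi satisfies
   E[e psi^H] = 0 and E|d psi|^2 > 0 for d <> 0, then Pythagoras makes A psi the
   unique linear minimizer.  It thus suffices to compute second moments.  In the
   covariance of two samples of psi, all cross terms vanish: each contains a
   factor whose law is symmetric given the other factors.  Independence splits
   the remaining ones into E[h h^*] and E[exp(i(phi(t)-phi(s)))], which is
   exp(-delta|t-s|/2) because the characteristic function u of N(0,s^2) solves
   u'(x) = - s^2 x u(x).  Conditionally on the channels the distortion is
   Gaussian, so its second moment is that of a variance mixture.  Finally Psi_j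
   is positive definite, as exp(-a|i-j|) is the correlation of an AR(1) process. *)
From HB Require Import structures.
From Pilot Require Import Defs.
From mathcomp Require Import all_boot all_order all_algebra.
From mathcomp Require Import all_classical all_reals all_analysis.
From mathcomp Require Import measurable_realfun lebesgue_integral_nonneg ring lra.
Import numFieldNormedType.Exports.

Set Implicit Arguments.
Unset Strict Implicit.
Unset Printing Implicit Defensive.

Import Order.TTheory GRing.Theory Num.Theory.
Local Open Scope classical_set_scope.
Local Open Scope ring_scope.
Local Open Scope complex_scope.

(** * Moments of the normal law *)

(** The model describes its sources only through masses of boxes and products of probabilities of
    events. Two devices turn this into moments. Measures of finite mass that agree on rectangles
    agree on the product sigma-algebra; hence a sign change of one real coordinate that preserves
    box masses preserves the joint law, and expectations odd in that coordinate vanish. This is what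
    handles the distortion, whose variance depends on the channels, so that its coordinates are
    uncorrelated without being independent. Secondly, the masses of the conditional law define a
    probability kernel w -> N(0, v(w)), and the law of each real distortion coordinate is the
    composition of P with that kernel.

    Channels at distinct antennas being uncorrelated, the covariance of psi_j is Psi_j tensor I_N.
    The normal equations thus split into N copies of a Psi_j = c, where c collects the covariances
    of h_n(t) with the B samples of antenna n; t >= B removes the absolute values from the exponents
    in c. The initial phase has an arbitrary law, so phases enter only through differences, whose
    law follows from the increments. *)

Lemma opp_div2_split (F : numFieldType) (a b : F) :
  - b / (a *+ 2) = - (b / (a *+ 4)) + - (b / (a *+ 4)).
Proof.
by rewrite (mulrnA a 2 2) -[(a *+ 2) *+ 2]mulr_natr invfM mulrA -opprD -splitr mulNr.
Qed.

Lemma opp_div2_double (F : numFieldType) (a b : F) :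
  - b / ((a * 2) *+ 2) = - (b / (a *+ 4)).
Proof.
by rewrite mulr_natr -mulrnA mulNr.
Qed.

Section Gauss.
Context {R : realType}.
Notation mu := (@lebesgue_measure R).

(** Integration by parts on the whole line: the fundamental theorem on [-(n+1), n+1] leaves boundary
    terms of size C/(n+1), and dominated convergence with bound |f| passes to the limit. *)
Lemma Rintegral_derive_eq0 (F f : R -> R) (C : R) :
  (forall x : R, is_derive x (1 : R) F (f x)) -> continuous f ->
  mu.-integrable setT (EFin \o f) -> (forall x, `|x * F x| <= C) ->
  \int[mu]_x f x = 0.
Proof.
move=> dF cf intf FC.
pose g n : R -> \bar R := EFin \o (f \_ `[- n.+1%:R, n.+1%:R]).
have FTC n : (\int[mu]_x g n x = (F n.+1%:R - F (- n.+1%:R))%:E)%E.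
  have -> : g n = (EFin \o f) \_ `[- n.+1%:R, n.+1%:R].
    by rewrite /g restrict_EFin.
  rewrite -integral_mkcond (@continuous_FTC2 _ f F) //.
  - by rewrite gtrN // ltr0n.
  - exact: continuous_subspaceT.
  - split.
    + by move=> x _; have := dF x; case.
    + apply: cvg_at_right_filter; apply: differentiable_continuous.
      by apply/derivable1_diffP; have := dF (- n.+1%:R); case.
    + apply: cvg_at_left_filter; apply: differentiable_continuous.
      by apply/derivable1_diffP; have := dF (n.+1%:R); case.
  - by move=> x _; rewrite derive1E; apply: derive_val.
have mf : measurable_fun setT f by exact: continuous_measurable_fun.
have mg n : measurable_fun setT (g n).
  apply/measurable_EFinP; apply/(measurable_restrictT _ _).1 => //.
  exact: measurable_funTS.
have gf : {ae mu, forall x, setT x -> g ^~ x @ \oo --> (EFin \o f) x}.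
  apply: aeW => x _; apply: cvg_near_cst.
  (* The truncation equals [f x] as soon as n + 1 exceeds |x|, so the sequence is eventually
     constant. *)
  exists (Num.truncn `|x|) => // n /= xn.
  rewrite /g /= /patch ifT // inE /= in_itv /= -ler_norml.
  by apply/ltW/(lt_le_trans (truncnS_gt _)); rewrite ler_nat ltnS.
have ig : mu.-integrable setT (abse \o (EFin \o f)) by exact: integrable_abse.
have gle : {ae mu, forall x n, setT x -> (`|g n x| <= (abse \o (EFin \o f)) x)%E}.
  apply: aeW => x n _; rewrite /g /= /patch; case: ifP => _ //.
  by rewrite normr0 lee_fin normr_ge0.
have mEf : measurable_fun setT (EFin \o f) by exact/measurable_EFinP.
have [_ _] := @dominated_convergence _ _ R mu setT measurableT g (EFin \o f) _
  mg mEf gf ig gle.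
have -> : [sequence (\int[mu]_x g n x)%E]_n =
  (fun n => (F n.+1%:R - F (- n.+1%:R))%:E).
  by apply/funext => n; exact: FTC.
move=> L.
(* Taking [e] to be 1 or -1 covers both endpoints; [harmonic n] is 1/(n+1). *)
have FC' (e : R) n : `|e| = 1 -> `|F (e * n.+1%:R)| <= C * harmonic n.
  move=> e1; rewrite /harmonic /= ler_pdivlMr ?ltr0n//.
  apply: le_trans (FC (e * n.+1%:R)).
  by rewrite !normrM e1 mul1r ger0_norm// mulrC.
have cC : C * harmonic n @[n --> \oo] --> (0 : R).
  by rewrite -[X in _ --> X](mulr0 C); apply: cvgMr; exact: cvg_harmonic.
have F0 (e : R) : `|e| = 1 -> F (e * n.+1%:R) @[n --> \oo] --> (0 : R).
  move=> e1; apply: norm_cvg0; apply: (squeeze_cvgr _ (cvg_cst 0) cC).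
  by apply: nearW => n; rewrite normr_ge0 FC'.
have L0 : F n.+1%:R - F (- n.+1%:R) @[n --> \oo] --> (0 : R).
  rewrite -[X in _ --> X](subr0 0); apply: cvgB.
    have := F0 1 (normr1 _).
    by rewrite (_ : (fun n => _) = (fun n => F n.+1%:R))//;
      apply/funext => n; rewrite mul1r.
  have := F0 (-1); rewrite normrN1 => /(_ erefl).
  by rewrite (_ : (fun n => _) = (fun n => F (- n.+1%:R)))//;
    apply/funext => n; rewrite mulN1r.
rewrite /Rintegral -[RHS]/(fine 0%:E); congr fine.
apply: (cvg_unique (@ereal_hausdorff R) L).
by apply/fine_cvgP; split => //; exact: nearW.
Qed.


Section normal_moments.
Variable s : R.
Hypothesis s0 : s != 0.
Let p := normal_pdf 0 s.

(** With y = x^2/(4 s^2) the density is proportional to exp(-y) exp(-y). One factor absorbs y, since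
    y <= exp(y); the other is a Gaussian of variance 2 s^2. *)
Lemma normal_pdf_sqr_le : exists2 C, 0 <= C &
  forall x, x ^+ 2 * p x <= C * normal_pdf 0 (s * Num.sqrt 2) x.
Proof.
have t0 : s * Num.sqrt 2 != 0 by rewrite mulf_neq0// gt_eqF// sqrtr_gt0.
have s2 : 0 < s ^+ 2 by rewrite exprn_even_gt0.
(* The factor 4 s^2 comes from x^2 = 4 s^2 y; the quotient of peaks exchanges the two normalising
   constants. *)
exists (s ^+ 2 *+ 4 * normal_peak s / normal_peak (s * Num.sqrt 2)) => [|x].
  by rewrite !mulr_ge0 ?invr_ge0 ?normal_peak_ge0// mulrn_wge0// ltW.
rewrite /p !normal_pdfE//.
rewrite [leRHS]mulrA divfK ?gt_eqF ?normal_peak_gt0//.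
rewrite mulrCA [leRHS]mulrAC [leRHS]mulrC ler_wpM2l ?normal_peak_ge0//.
rewrite /normal_fun subr0 exprMn sqr_sqrtr//.
set y := x ^+ 2 / (s ^+ 2 *+ 4).
have xy : x ^+ 2 = s ^+ 2 *+ 4 * y.
  by rewrite /y mulrC divfK// mulrn_eq0/= gt_eqF.
have -> : - x ^+ 2 / (s ^+ 2 *+ 2) = - y + - y.
  by rewrite opp_div2_split.
have -> : - x ^+ 2 / ((s ^+ 2 * 2) *+ 2) = - y.
  by rewrite opp_div2_double.
rewrite expRD xy -[leLHS]mulrA ler_wpM2l//; first by rewrite mulrn_wge0// ltW.
rewrite mulrA -[leRHS]mul1r ler_wpM2r ?expR_ge0// expRN.
rewrite ler_pdivrMr ?expR_gt0// mul1r.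
by apply: le_trans (expR_ge1Dx y); rewrite lerDr ler01.
Qed.

Let continuous_pdf : continuous p.
Proof. exact: continuous_normal_pdf. Qed.

Let pdf_ge0 x : 0 <= p x.
Proof. exact: normal_pdf_ge0. Qed.

Lemma integrable_sqr_normal_pdf : mu.-integrable setT (fun x => (x ^+ 2 * p x)%:E).
Proof.
have [C C0 H] := normal_pdf_sqr_le.
apply: (@le_integrable _ _ R mu setT measurableT _
  (fun x => (C%:E * (normal_pdf 0 (s * Num.sqrt 2) x)%:E)%E)) => //.
- apply/measurable_EFinP; apply: measurable_funM => //.
  exact: measurable_normal_pdf.
- move=> x _; rewrite -EFinM !abse_EFin lee_fin !ger0_norm ?H//.
    by rewrite mulr_ge0 ?normal_pdf_ge0.
  by rewrite mulr_ge0 ?pdf_ge0 ?sqr_ge0.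
- by apply: integrableZl => //; exact: integrable_normal_pdf.
Qed.

(** Provides the boundary constant that [Rintegral_derive_eq0] asks for. *)
Lemma sqr_normal_pdf_bounded : exists C, forall x, x ^+ 2 * p x <= C.
Proof.
have [C C0 H] := normal_pdf_sqr_le.
exists (C * normal_peak (s * Num.sqrt 2)) => x; apply: (le_trans (H x)).
rewrite ler_wpM2l// normal_pdf_ub//.
by rewrite mulf_neq0// gt_eqF// sqrtr_gt0.
Qed.

Let is_derive_normal_pdf x : is_derive x (1 : R) p (- (x / s ^+ 2) * p x).
Proof.
have -> : p = (fun x => normal_peak s * expR (- (s ^+ 2 *+ 2)^-1 * x ^+ 2)).
  apply/funext => y; rewrite /p normal_pdfE// /normal_fun subr0.
  by congr (_ * expR _); rewrite !mulNr mulrC.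
apply: is_derive_eq.
by rewrite /GRing.scale /= -mulr_natr; field.
Qed.

Lemma integrable_normal_pdf_growth (f : R -> R) C : measurable_fun setT f ->
  (forall x, `|f x| <= C * (1 + x ^+ 2)) ->
  mu.-integrable setT (fun x => (f x * p x)%:E).
Proof.
move=> mf H.
apply: (@le_integrable _ _ R mu setT measurableT _
  (fun x => (C%:E * ((p x)%:E + (x ^+ 2 * p x)%:E))%E)) => //.
- apply/measurable_EFinP; apply: measurable_funM => //.
  exact: measurable_normal_pdf.
- move=> x _; rewrite -EFinD -EFinM !abse_EFin lee_fin.
  rewrite [leLHS]normrM (ger0_norm (pdf_ge0 x)).
  apply: le_trans (ler_norm _).
  rewrite [leRHS](_ : _ = C * (1 + x ^+ 2) * p x); last by ring.
  by rewrite ler_wpM2r ?pdf_ge0.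
- apply: integrableZl => //; apply: integrableD => //.
    exact: integrable_normal_pdf.
  exact: integrable_sqr_normal_pdf.
Qed.

(** The derivative of x p(x) is p(x) - x^2 p(x) / s^2, and its integral vanishes. *)
Lemma normal_second_moment : \int[mu]_x (x ^+ 2 * p x) = s ^+ 2.
Proof.
have [C HC] := sqr_normal_pdf_bounded.
have s2 : s ^+ 2 != 0 by rewrite expf_neq0.
have i2 : mu.-integrable setT (EFin \o (fun x => (s ^- 2 * (x ^+ 2 * p x)))).
  by under [X in mu.-integrable _ X]eq_fun do rewrite /= EFinM;
    apply: integrableZl => //; exact: integrable_sqr_normal_pdf.
have := @Rintegral_derive_eq0 (fun x => x * p x)
  (fun x => p x - s ^- 2 * (x ^+ 2 * p x)) C _ _ _ _.
have i1 : mu.-integrable setT (EFin \o p) by exact: integrable_normal_pdf.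
rewrite RintegralB// RintegralZl//; last exact: integrable_sqr_normal_pdf.
have -> : \int[mu]_x p x = 1 by rewrite /Rintegral integral_normal_pdf.
move=> H; have /eqP : 1 - s ^- 2 * \int[mu]_x (x ^+ 2 * p x) = 0.
  apply: H.
  - move=> x; have := is_derive_normal_pdf x => ?; apply: is_derive_eq.
    by rewrite /GRing.scale /=; field.
  - move=> x; apply: cvgB; first exact: continuous_pdf.
    apply: cvgM; first exact: cvg_cst.
    by apply: cvgM; [exact: exprn_continuous|exact: continuous_pdf].
  - by under [X in mu.-integrable _ X]eq_fun do rewrite /= EFinB;
      exact: integrableB.
  - by move=> x; rewrite mulrA -expr2 ger0_norm// mulr_ge0 ?sqr_ge0 ?pdf_ge0.
rewrite subr_eq0 => /eqP H1.
by rewrite -[LHS](mulVKf s2) -H1 mulr1.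
Qed.

(** Real part of the characteristic function. The frequency [u] is kept variable, although only u =
    1 is needed in the end, so that a differential equation in [u] can be derived. *)
Let phi (u : R) := \int[mu]_x (cos (u * x) * p x).

Lemma normr_cos_le1 (x : R) : `|cos x| <= 1.
Proof. by rewrite ler_norml cos_geN1 cos_le1. Qed.

Lemma normr_sin_le1 (x : R) : `|sin x| <= 1.
Proof. by rewrite ler_norml sin_geN1 sin_le1. Qed.

Lemma measurable_cosM (u : R) : measurable_fun setT (fun x => cos (u * x)).
Proof.
apply: continuous_measurable_fun => x.
apply: continuous_comp; last exact: continuous_cos.
by apply: cvgM; [exact: cvg_cst|exact: cvg_id].
Qed.

Lemma measurable_sinM (u : R) : measurable_fun setT (fun x => sin (u * x)).
Proof.
apply: continuous_measurable_fun => x.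
apply: continuous_comp; last exact: continuous_sin.
by apply: cvgM; [exact: cvg_cst|exact: cvg_id].
Qed.

Lemma integrable_cos_normal_pdf u : mu.-integrable setT (fun x => (cos (u * x) * p x)%:E).
Proof.
apply: (@integrable_normal_pdf_growth _ 1); first exact: measurable_cosM.
move=> x; rewrite mul1r (le_trans (normr_cos_le1 _))// lerDl sqr_ge0 //.
Qed.

Lemma normr_le_1Dsqr (x : R) : `|x| <= 1 + x ^+ 2.
Proof.
rewrite -[x ^+ 2]real_normK ?num_real//; have := normr_ge0 x.
by move: `|x| => y y0; nra.
Qed.

Lemma integrable_xsin_normal_pdf u :
  mu.-integrable setT (fun x => (x * sin (u * x) * p x)%:E).
Proof.
apply: (@integrable_normal_pdf_growth _ 1).
  by apply: measurable_funM => //; exact: measurable_sinM.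
move=> x; rewrite mul1r (le_trans _ (normr_le_1Dsqr x))// normrM.
by rewrite ler_piMr// normr_sin_le1.
Qed.

(** Stein's identity E[X g(X)] = s^2 E[g'(X)] for g(x) = sin(u x), obtained by integrating the
    derivative of g p. *)
Let Rintegral_xsin_normal_pdf u : \int[mu]_x (x * sin (u * x) * p x) = s ^+ 2 * u * phi u.
Proof.
have [C HC] := sqr_normal_pdf_bounded.
have s2 : s ^+ 2 != 0 by rewrite expf_neq0.
have i2 : mu.-integrable setT
    (EFin \o (fun x => (s ^- 2 * (x * sin (u * x) * p x)))).
  by under [X in mu.-integrable _ X]eq_fun do rewrite /= EFinM;
    apply: integrableZl => //; exact: integrable_xsin_normal_pdf.
have i1 : mu.-integrable setT (EFin \o (fun x => u * (cos (u * x) * p x))).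
  by under [X in mu.-integrable _ X]eq_fun do rewrite /= EFinM;
    apply: integrableZl => //; exact: integrable_cos_normal_pdf.
have := @Rintegral_derive_eq0 (fun x => sin (u * x) * p x)
  (fun x => u * (cos (u * x) * p x) - s ^- 2 * (x * sin (u * x) * p x))
  (* Bounds |x sin(u x) p(x)| through |x| <= 1 + x^2: the peak bounds p(x) and [C] bounds x^2
     p(x). *)
  (normal_peak s + C) _ _ _ _.
rewrite RintegralB// !RintegralZl//;
  [|exact: integrable_xsin_normal_pdf|exact: integrable_cos_normal_pdf].
move=> H; have /eqP : u * phi u - s ^- 2 * \int[mu]_x (x * sin (u * x) * p x) = 0.
  apply: H.
  - move=> x; have := is_derive_normal_pdf x => ?; apply: is_derive_eq.
    by rewrite /GRing.scale /=; field.
  - have cu (x : R) : {for x, continuous (fun x : R => u * x)}.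
      by apply: cvgM; [exact: cvg_cst|exact: cvg_id].
    move=> x; apply: cvgB; apply: cvgM; try exact: cvg_cst.
      apply: cvgM; last exact: continuous_pdf.
      by apply: (@continuous_comp _ _ _ (fun x => u * x) cos) => //; exact: continuous_cos.
    apply: cvgM; last exact: continuous_pdf.
    apply: cvgM; first exact: cvg_id.
    by apply: (@continuous_comp _ _ _ (fun x => u * x) sin) => //; exact: continuous_sin.
  - by under [X in mu.-integrable _ X]eq_fun do rewrite /= EFinB;
      exact: integrableB.
  - move=> x; rewrite mulrCA normrM (le_trans (ler_piMl _ (normr_sin_le1 _)))//.
    rewrite normrM (ger0_norm (pdf_ge0 x)).
    apply: le_trans (ler_wpM2r (pdf_ge0 x) (normr_le_1Dsqr x)) _.
    by rewrite mulrDl mul1r lerD// normal_pdf_ub.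
rewrite subr_eq0 => /eqP H1.
by rewrite -mulrA H1 mulVKf.
Qed.

(** Differentiation under the integral sign produces -E[X sin(u X)], which Stein's identity rewrites
    in terms of [phi] itself. *)
Let is_derive_phi u : is_derive u (1 : R) phi (- (s ^+ 2 * u * phi u)).
Proof.
pose f (v x : R) := cos (v * x) * p x.
have df v x : is_derive v (1 : R) (f ^~ x) (- (x * sin (v * x) * p x)).
  by apply: is_derive_eq; rewrite /GRing.scale /=; ring.
have d1 v x : partial1of2 f v x = - (x * sin (v * x) * p x).
  by rewrite partial1of2E; apply: derive_val.
have i1 v : `](u - 1), (u + 1)[%classic v ->
  mu.-integrable setT (EFin \o f v) by move=> _; exact: integrable_cos_normal_pdf.
have Iu : `](u - 1), (u + 1)[%classic u.
  by rewrite /= in_itv /= ltrBlDr ltrDl ltr01.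
have dv v x : `](u - 1), (u + 1)[%classic v -> setT x -> derivable (f ^~ x) v 1.
  by move=> _ _; have := df v x; case.
(* An integrable bound for |x sin(v x)| p(x) that is uniform in [v]. *)
pose G x := (1 + x ^+ 2) * p x.
have G0 x : 0 <= G x by rewrite mulr_ge0 ?pdf_ge0// addr_ge0 ?sqr_ge0.
have iG : mu.-integrable setT (EFin \o G).
  apply: (@integrable_normal_pdf_growth _ 1); first by apply: measurable_funD.
  by move=> x; rewrite mul1r ger0_norm// addr_ge0 ?sqr_ge0.
have dG v x : `](u - 1), (u + 1)[%classic v -> setT x -> `|partial1of2 f v x| <= G x.
  move=> _ _; rewrite d1 normrN normrM (ger0_norm (pdf_ge0 x)) ler_wpM2r ?pdf_ge0//.
  by rewrite normrM (le_trans _ (normr_le_1Dsqr x))// ler_piMr// normr_sin_le1.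
have D := @derivable_under_integral R _ _ mu f setT measurableT u _ _ Iu i1 dv G G0 iG dG.
apply: DeriveDef; first exact: D.
have := @differentiation_under_integral R _ _ mu f setT measurableT u _ _ Iu i1 dv G G0 iG dG.
rewrite derive1E => ->.
under eq_Rintegral do rewrite d1 -mulN1r.
rewrite RintegralZl//; last exact: integrable_xsin_normal_pdf.
by rewrite Rintegral_xsin_normal_pdf mulN1r.
Qed.

(** By the equation for [phi], the product phi(u) exp(s^2 u^2 / 2) has derivative zero; its values
    at 1 and 0 are compared. *)
Lemma normal_charfun : \int[mu]_x (cos x * p x) = expR (- s ^+ 2 / 2).
Proof.
have H u v : phi u * expR (s ^+ 2 / 2 * u ^+ 2) =
             phi v * expR (s ^+ 2 / 2 * v ^+ 2).
  apply: (@is_derive_0_is_cst R (fun u => phi u * expR (s ^+ 2 / 2 * u ^+ 2))).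
  move=> x; have := is_derive_phi x => ?; apply: is_derive_eq.
  by rewrite /GRing.scale /=; field.
have := H 1 0; rewrite expr1n mulr1 expr0n mulr0 expR0 mulr1.
have -> : phi 0 = 1.
  rewrite /phi; under eq_Rintegral do rewrite mul0r cos0 mul1r.
  by rewrite /Rintegral integral_normal_pdf.
have -> : phi 1 = \int[mu]_x (cos x * p x).
  by apply: eq_Rintegral => x _; rewrite mul1r.
by move=> H1; rewrite mulNr expRN -[LHS](mulfK (lt0r_neq0 (expR_gt0 (s ^+ 2 / 2)))) H1 mul1r.
Qed.

Lemma normal_probN (U : set R) : measurable U ->
  normal_prob 0 s (-%R @^-1` U) = normal_prob 0 s U.
Proof.
move=> mU; rewrite /normal_prob.
have pN x : p (- x) = p x.
  by rewrite /p !normal_pdfE// /normal_fun !subr0 sqrrN.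
under eq_integral do rewrite -[normal_pdf 0 s _]pN.
transitivity (\int[pushforward mu (-%R : R -> measurableTypeR R)]_(x in U) (p x)%:E)%E.
  rewrite ge0_integral_pushforward//.
  - by apply/measurable_EFinP; apply: measurable_funTS; exact: measurable_normal_pdf.
  - by move=> x _; rewrite lee_fin pdf_ge0.
rewrite -/p.
by apply: eq_measure_integral => //= A mA _; exact: lebesgue_measureN.
Qed.

End normal_moments.
End Gauss.

(** * Centered normal laws, the point mass at variance 0 included *)

Section CenteredNormal.
Context {R : realType}.
Notation mu := (@lebesgue_measure R).

(** The Radon-Nikodym derivative is determined only almost everywhere; it agrees there with
    [normal_pdf] because both have the same integral over every measurable set. *)
Lemma ge0_integral_normal_prob (m s : R) (f : R -> \bar R) :
  (forall x, 0 <= f x)%E -> measurable_fun setT f ->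
  (\int[normal_prob m s]_x f x = \int[mu]_x (f x * (normal_pdf m s x)%:E))%E.
Proof.
move=> f0 mf; have dom := normal_prob_dominates m s.
rewrite -(Radon_Nikodym_SigmaFinite.change_of_variables dom)//.
apply: ae_eq_integral => //.
- apply: emeasurable_funM => //; apply: (measurable_int mu).
  exact: Radon_Nikodym_SigmaFinite.f_integrable.
- apply: emeasurable_funM => //=; apply/measurableT_comp => //=.
  exact: measurable_normal_pdf.
- apply: ae_eqe_mul2l => /=; apply: integral_ae_eq => //=.
  + exact: Radon_Nikodym_SigmaFinite.f_integrable.
  + by apply/measurableT_comp => //; exact: measurable_normal_pdf.
  + by move=> E _ mE; rewrite -Radon_Nikodym_SigmaFinite.f_integral.
Qed.

(** [centered_normal] is a mere set function; bundling it as a measure allows integration against it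
    and its use as a kernel. *)
Definition cnormal_measure (v : R) : {measure set (measurableTypeR R) -> \bar R} :=
  if v == 0
  then (@dirac _ (measurableTypeR R) 0 R : {measure set (measurableTypeR R) -> \bar R})
  else normal_prob 0 (Num.sqrt v).

Lemma cnormal_measureE (v : R) (U : set R) : cnormal_measure v U = centered_normal v U.
Proof. by rewrite /cnormal_measure /centered_normal; case: ifP. Qed.

Lemma centered_normalT (v : R) : centered_normal v setT = 1%E.
Proof.
rewrite /centered_normal; case: ifP => _; last exact: probability_setT.
by rewrite diracT.
Qed.

Lemma centered_normalN (v : R) (U : set R) : 0 <= v -> measurable U ->
  centered_normal v (-%R @^-1` U) = centered_normal v U.
Proof.
move=> v0 mU; rewrite /centered_normal; case: ifPn => v1.
  by rewrite /dirac/= !indicE; congr ((_ _)%:R)%:E; apply/idP/idP;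
    rewrite !inE/= oppr0.
by apply: normal_probN => //; rewrite sqrtr_eq0 -ltNge lt_def v1.
Qed.

Lemma cnormal_second_moment (v : R) : 0 <= v ->
  (\int[cnormal_measure v]_x (x ^+ 2)%:E)%E = v%:E.
Proof.
move=> v0; rewrite /cnormal_measure; case: ifPn => [/eqP ->|v1].
  rewrite integral_dirac//= ?diracT ?mul1e ?expr0n//.
  by apply/measurable_EFinP; exact: measurable_funX.
have s0 : Num.sqrt v != 0 by rewrite sqrtr_eq0 -ltNge lt_def v1.
rewrite ge0_integral_normal_prob; last 2 first.
- by move=> x; rewrite lee_fin sqr_ge0.
- by apply/measurable_EFinP; exact: measurable_funX.
under eq_integral do rewrite -EFinM.
rewrite -[LHS]fineK; last by apply: integrable_fin_num => //; exact: integrable_sqr_normal_pdf.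
by rewrite [fine _](normal_second_moment s0) sqr_sqrtr.
Qed.

(** The summand 1 makes the integrand nonnegative, so that the change of variables for nonnegative
    functions applies; it is subtracted later. *)
Lemma cnormal_charfun (v : R) : 0 <= v ->
  (\int[cnormal_measure v]_x (1 + cos x)%:E)%E = (1 + expR (- (v / 2)))%:E.
Proof.
have c0 (x : R) : 0 <= 1 + cos x by have := cos_geN1 x; lra.
have mc : measurable_fun setT (fun x : R => (1 + cos x)%:E).
  apply/measurable_EFinP; apply: measurable_funD => //.
  by apply: continuous_measurable_fun; exact: continuous_cos.
move=> v0; rewrite /cnormal_measure; case: ifPn => [/eqP ->|v1].
  by rewrite integral_dirac//= ?diracT ?mul1e// cos0 mul0r oppr0 expR0.
have s0 : Num.sqrt v != 0 by rewrite sqrtr_eq0 -ltNge lt_def v1.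
rewrite ge0_integral_normal_prob//.
under eq_integral do rewrite -EFinM mulrDl mul1r EFinD.
have i1 := integrable_normal_pdf 0 (Num.sqrt v).
have i2 : mu.-integrable setT (fun x => (cos x * normal_pdf 0 (Num.sqrt v) x)%:E).
  have := integrable_cos_normal_pdf s0 1.
  by under eq_fun do rewrite mul1r.
rewrite integralD// integral_normal_pdf.
rewrite -[X in (_ + X)%E]fineK; last exact: integrable_fin_num.
by rewrite [fine _](normal_charfun s0) sqr_sqrtr// mulNr.
Qed.

End CenteredNormal.

Section Law.
Context {R : realType} {d : measure_display} {Om : measurableType d}.
Variable P : probability Om R.

Lemma ge0_integral_normal_law (X : Om -> R) (v : R) (f : R -> \bar R) :
  measurable_fun setT X ->
  (forall U, measurable U -> P (X @^-1` U) = centered_normal v U) ->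
  measurable_fun setT f -> (forall x, 0 <= f x)%E ->
  (\int[P]_w f (X w) = \int[cnormal_measure v]_x f x)%E.
Proof.
move=> mX law mf f0.
transitivity (\int[pushforward P (X : Om -> measurableTypeR R)]_x f x)%E.
  by rewrite ge0_integral_pushforward.
by apply: eq_measure_integral => /= A mA _; rewrite cnormal_measureE -law.
Qed.

End Law.

(** * Normal law with a random variance *)

Section Mixture.
Context {R : realType} {d : measure_display} {Om : measurableType d}.
Variables (P : probability Om R) (X v : Om -> R).
Hypothesis mX : measurable_fun setT X.
Hypothesis v0 : forall w, 0 <= v w.
Hypothesis mk : forall U : set R, measurable U ->
  measurable_fun setT (fun w => fine (centered_normal (v w) U)).
Hypothesis law : forall U : set R, measurable U ->
  P (X @^-1` U) = (\int[P]_w (fine (centered_normal (v w) U))%:E)%E.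

(** The idle component in [unit] gives [k] the shape that kernel composition expects: its source is
    a pair of the first kernel's source and target. *)
Let k (x : unit * Om) : {measure set (measurableTypeR R) -> \bar R} :=
  cnormal_measure (v x.2).

Let k_setT x : k x setT = 1%E.
Proof. by rewrite /k cnormal_measureE centered_normalT. Qed.

Let k_fin x U : measurable U -> k x U \is a fin_num.
Proof.
move=> mU; rewrite ge0_fin_numE//; apply: (@le_lt_trans _ _ (k x setT)).
  by apply: le_measure; rewrite ?inE//.
by rewrite k_setT ltry.
Qed.

Let k_measurable (U : set (measurableTypeR R)) : measurable U ->
  measurable_fun [set: unit * Om] (k ^~ U).
Proof.
move=> mU.
have -> : k ^~ U = (fun x => (fine (centered_normal (v x.2) U))%:E).
  by apply/funext => x; rewrite -cnormal_measureE fineK// k_fin.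
apply/measurable_EFinP.
by apply: (measurableT_comp (mk mU)); exact: measurable_snd.
Qed.

HB.instance Definition _ := isKernel.Build _ _ _ _ _ k k_measurable.
HB.instance Definition _ := Kernel_isProbability.Build _ _ _ _ _ k k_setT.

(* The law of X is the composition of P, seen as a kernel from a point, with k. *)
Let l := kprobability (measurable_cst (P : pprobability Om R) : measurable_fun [set: unit] _).

(** Integrating against a composed kernel is iterated integration, and the inner integral of x^2
    against N(0, v(w)) is v(w). Both sides are integrals of nonnegative functions, so the identity
    holds before integrability is known and can be used to prove it. *)
Lemma mixture_second_moment :
  (\int[P]_w (X w ^+ 2)%:E = \int[P]_w (v w)%:E)%E.
Proof.
have m2 : measurable_fun setT (fun x : R => (x ^+ 2)%:E).
  by apply/measurable_EFinP; exact: measurable_funX.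
have p2 (x : R) : (0 <= (x ^+ 2)%:E)%E by rewrite lee_fin sqr_ge0.
transitivity (\int[pushforward P (X : Om -> measurableTypeR R)]_x (x ^+ 2)%:E)%E.
  by rewrite ge0_integral_pushforward.
transitivity (\int[kcomp l k tt]_x (x ^+ 2)%:E)%E.
  apply: eq_measure_integral => /= A mA _; rewrite /pushforward law// /kcomp.
  apply: eq_integral => w _; rewrite /k cnormal_measureE fineK//.
  by rewrite -cnormal_measureE (k_fin (tt, w)).
rewrite integral_kcomp//.
by apply: eq_integral => w _; rewrite cnormal_second_moment.
Qed.

End Mixture.

(** * Product laws and symmetry *)

Section Independence.
Context {R : realType} {d : measure_display} {Om : measurableType d}.
Variable P : probability Om R.

(** Rectangles are stable under intersection and generate the product sigma-algebra, and [setT] is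
    itself a rectangle of finite mass, so uniqueness of measures applies with a constant exhausting
    sequence. *)
Lemma eq_measure_prod d1 d2 (T1 : measurableType d1) (T2 : measurableType d2)
    (m1 m2 : {measure set (T1 * T2) -> \bar R}) :
  (m1 setT < +oo)%E ->
  (forall A B, measurable A -> measurable B -> m1 (A `*` B) = m2 (A `*` B)) ->
  forall X, measurable X -> m1 X = m2 X.
Proof.
move=> fin1 H X mX.
pose C : set (set (T1 * T2)) :=
  [set C | exists A, measurable A /\ exists B, measurable B /\ C = A `*` B].
apply: (measure_unique C (fun=> setT)) => //.
- rewrite measurable_prod_measurableType //; congr (<<s _ >>).
  rewrite predeqE; split => [[A mA [B mB <-]]|[A [mA [B [mB ->]]]]].
    by exists A; split => //; exists B.
  by exists A => //; exists B.
- move=> /= _ _ [X1 [mX1 [X2 [mX2 ->]]]] [Y1 [mY1 [Y2 [mY2 ->]]]].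
  rewrite -setXI; exists (X1 `&` Y1); split; first exact: measurableI.
  by exists (X2 `&` Y2); split => //; exact: measurableI.
- by move=> _; exists setT; split => //; exists setT; split => //; rewrite setXTT.
- by rewrite bigcup_const//; exists 0%N.
- by move=> A [A1 [mA1 [A2 [mA2 ->]]]]; exact: H.
Qed.

Definition indep_rv (X Y : Om -> R) := forall U V : set R,
  measurable U -> measurable V ->
  P (X @^-1` U `&` Y @^-1` V) = (P (X @^-1` U) * P (Y @^-1` V))%E.

(** By independence the law of (X, Y) is the product of the marginal laws. Tonelli then gives
    integrability of the product and Fubini its value. *)
Lemma expectation_indep_mul (X Y : Om -> R) :
  P.-integrable setT (EFin \o X) -> P.-integrable setT (EFin \o Y) ->
  indep_rv X Y ->
  P.-integrable setT (fun w => (X w * Y w)%:E) /\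
  fine 'E_P[fun w => X w * Y w] = fine 'E_P[X] * fine 'E_P[Y].
Proof.
move=> iX iY ind.
have mX : measurable_fun setT X by exact/measurable_EFinP/(measurable_int P).
have mY : measurable_fun setT Y by exact/measurable_EFinP/(measurable_int P).
pose X' : {mfun Om >-> measurableTypeR R} := @mfun_Sub _ _ Om (measurableTypeR R) _ (mem_set mX).
pose Y' : {mfun Om >-> measurableTypeR R} := @mfun_Sub _ _ Om (measurableTypeR R) _ (mem_set mY).
pose m1 : probability (measurableTypeR R) R := distribution P X'.
pose m2 : probability (measurableTypeR R) R := distribution P Y'.
have mXY : measurable_fun setT (fun w => (X' w, Y' w)).
  exact: measurable_fun_pair.
have E A : measurable A -> (m1 \x m2)%E A = pushforward P (fun w => (X' w, Y' w)) A.
  apply: product_measure_unique => U V mU mV /=.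
  by rewrite /pushforward -ind.
pose f (z : measurableTypeR R * measurableTypeR R) := (z.1 * z.2)%:E.
have mf : measurable_fun setT f.
  apply/measurable_EFinP; apply: measurable_funM.
    exact: measurable_fst.
  exact: measurable_snd.
have ia1 : (\int[m1]_x `|x%:E| < +oo)%E.
  rewrite ge0_integral_pushforward//; first by case/integrableP: iX.
  by apply: measurableT_comp => //; exact/measurable_EFinP.
have ia2 : (\int[m2]_x `|x%:E| < +oo)%E.
  rewrite ge0_integral_pushforward//; first by case/integrableP: iY.
  by apply: measurableT_comp => //; exact/measurable_EFinP.
have id2 : m2.-integrable setT (fun y : measurableTypeR R => (y : R)%:E).
  by apply/integrableP; split => //; exact/measurable_EFinP.
have id1 : m1.-integrable setT (fun y : measurableTypeR R => (y : R)%:E).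
  by apply/integrableP; split => //; exact/measurable_EFinP.
have intf : (m1 \x m2)%E.-integrable setT f.
  apply: (integrable12ltyP m1 m2 mf).2.
  have -> : (fun x => \int[m2]_y `|f (x, y)|)%E =
            (fun x => `|x%:E| * \int[m2]_y `|y%:E|)%E.
    apply/funext => x; rewrite -ge0_integralZl//.
      by apply: eq_integral => y _; rewrite /f /= normrM EFinM.
    by apply: measurableT_comp => //; exact/measurable_EFinP.
  rewrite ge0_integralZr//; first by rewrite lte_mul_pinfty// ?integral_ge0//
     ge0_fin_numE// integral_ge0.
    by apply: measurableT_comp => //; exact/measurable_EFinP.
  exact: integral_ge0.
have intf' : (pushforward P (fun w => (X' w, Y' w))).-integrable setT f.
  case/integrableP: intf => _ H; apply/integrableP; split => //.
  rewrite (_ : integral _ _ _ = \int[(m1 \x m2)%E]_x `|f x|)%E//.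
  by apply: eq_measure_integral => A mA _; exact/esym/E.
have iXY : P.-integrable setT (fun w => (X w * Y w)%:E).
  case/integrableP: intf' => _ H; apply/integrableP; split => //.
    by apply/measurable_EFinP; apply: measurable_funM.
  by move: H; rewrite ge0_integral_pushforward//; exact: measurableT_comp.
split=> //; rewrite unlock.
have -> : (\int[P]_w (X w * Y w)%:E = \int[m1 \x m2]_z f z)%E.
  transitivity (\int[pushforward P (fun w => (X' w, Y' w))]_z f z)%E.
    by rewrite integral_pushforward.
  by apply: eq_measure_integral => A mA _; exact/esym/E.
rewrite -integral12_prod_meas1//.
have eY : (\int[m2]_y y%:E = \int[P]_w (Y w)%:E)%E.
  by rewrite integral_pushforward//; exact/measurable_EFinP.
have eX : (\int[m1]_y y%:E = \int[P]_w (X w)%:E)%E.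
  by rewrite integral_pushforward//; exact/measurable_EFinP.
have fY : (\int[m2]_y y%:E)%E \is a fin_num by exact: integrable_fin_num.
have fX : (\int[m1]_y y%:E)%E \is a fin_num by exact: integrable_fin_num.
have -> : (fun x => \int[m2]_y f (x, y))%E = (fun x => x%:E * \int[m2]_y y%:E)%E.
  by apply/funext => x; rewrite -integralZl.
by rewrite -(fineK fY) integralZr// fineM// eX eY.
Qed.

(** The pairs (Z, X) and (Z, -X) have the same law, as their laws agree on rectangles; therefore the
    expectation equals its own opposite. *)
Lemma expectation_odd_eq0 d1 (T1 : measurableType d1) (Z : Om -> T1) (X : Om -> R)
    (f : T1 -> R) :
  measurable_fun setT Z -> measurable_fun setT X -> measurable_fun setT f ->
  (forall A V, measurable A -> measurable V ->
    P (Z @^-1` A `&` X @^-1` V) = P (Z @^-1` A `&` X @^-1` (-%R @^-1` V))) ->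
  P.-integrable setT (fun w => (f (Z w) * X w)%:E) ->
  fine 'E_P[fun w => f (Z w) * X w] = 0.
Proof.
move=> mZ mX mf sym int; rewrite unlock.
have mN : measurable_fun setT (fun w => - X w) by exact: measurableT_comp.
pose m1 := pushforward P (fun w => (Z w, X w : measurableTypeR R)).
pose m2 := pushforward P (fun w => (Z w, - X w : measurableTypeR R)).
have mm1 : measurable_fun setT (fun w => (Z w, X w : measurableTypeR R)).
  exact: measurable_fun_pair.
have mm2 : measurable_fun setT (fun w => (Z w, - X w : measurableTypeR R)).
  exact: measurable_fun_pair.
have E A : measurable A -> m1 A = m2 A.
  apply: eq_measure_prod => [|U V mU mV].
    by rewrite -[X in (X < _)%E]/(P setT) probability_setT ltry.
  exact: sym.
pose g (z : T1 * measurableTypeR R) := (f z.1 * z.2)%:E.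
have mg : measurable_fun setT g.
  apply/measurable_EFinP; apply: measurable_funM.
    by apply: measurableT_comp => //; exact: measurable_fst.
  exact: measurable_snd.
have H : (\int[P]_w (f (Z w) * X w)%:E = \int[P]_w (f (Z w) * - X w)%:E)%E.
  transitivity (\int[m1]_z g z)%E; first by rewrite integral_pushforward.
  transitivity (\int[m2]_z g z)%E; first by apply: eq_measure_integral => A mA _; exact: E.
  rewrite integral_pushforward//.
  have := integrableN int; apply: eq_integrable => // w _.
  by rewrite /g /= mulrN EFinN.
move: H; under [in RHS]eq_integral do rewrite mulrN -mulN1r EFinM.
rewrite [in X in _ = X -> _]integralZl//.
(* Finiteness matters here: I = -I gives I = 0 only for a real number. *)
move: (integrable_fin_num measurableT int).
case: (integral _ _ _) => // r _; rewrite -EFinM => -[] /=; lra.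
Qed.

Lemma expectation_odd3_eq0 (c h X : Om -> R) :
  measurable_fun setT c -> measurable_fun setT h -> measurable_fun setT X ->
  (forall A B V, measurable A -> measurable B -> measurable V ->
    P (c @^-1` A `&` h @^-1` B `&` X @^-1` V) =
    P (c @^-1` A `&` h @^-1` B `&` X @^-1` (-%R @^-1` V))) ->
  P.-integrable setT (fun w => (c w * h w * X w)%:E) ->
  fine 'E_P[fun w => c w * h w * X w] = 0.
Proof.
move=> mc mh mX sym int.
have mch : measurable_fun setT (fun w => (c w, h w)) by exact: measurable_fun_pair.
apply: (@expectation_odd_eq0 _ (measurableTypeR R * measurableTypeR R)%type
  (fun w => (c w, h w)) X (fun z => z.1 * z.2)) => //.
  by apply: measurable_funM; [exact: measurable_fst|exact: measurable_snd].
move=> A V mA mV.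
have mXV (W : set R) : measurable W -> measurable (X @^-1` W).
  by move=> mW; rewrite -[_ @^-1` _]setTI; exact: mX.
have mNV : measurable (-%R @^-1` V : set R).
  by rewrite -[_ @^-1` _]setTI; exact: (@oppr_measurable R setT).
(* The symmetry is known for products of events in [c] and [h] only. Restricting P to each of the
   two events on [X] and pushing forward by (c, h) gives finite measures that agree on rectangles,
   hence on every event of the pair. *)
pose m1 := pushforward (mrestr P (mXV _ mV))
  (fun w => (c w, h w) : measurableTypeR R * measurableTypeR R).
pose m2 := pushforward (mrestr P (mXV _ mNV))
  (fun w => (c w, h w) : measurableTypeR R * measurableTypeR R).
apply: (@eq_measure_prod _ _ _ _ m1 m2) => // [|U W mU mW].
  rewrite -[X in (X < _)%E]/(P (setT `&` X @^-1` V)) setTI.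
  by apply: le_lt_trans (probability_le1 _ _) _; rewrite ?ltry//; exact: (mXV _ mV).
exact: sym.
Qed.

End Independence.

(** * Complex second moments and the LMMSE estimator *)

Section ComplexFacts.
Context {R : realType}.
Implicit Types z u : R[i].

Lemma cReM z u : complex.Re (z * u) =
  complex.Re z * complex.Re u - complex.Im z * complex.Im u.
Proof. by case: z u => [a b] [c e]. Qed.

Lemma cImM z u : complex.Im (z * u) =
  complex.Re z * complex.Im u + complex.Im z * complex.Re u.
Proof. by case: z u => [a b] [c e]. Qed.

Lemma cReD z u : complex.Re (z + u) = complex.Re z + complex.Re u.
Proof. by case: z u => [a b] [c e]. Qed.

Lemma cImD z u : complex.Im (z + u) = complex.Im z + complex.Im u.
Proof. by case: z u => [a b] [c e]. Qed.

Lemma cReJ z : complex.Re (conjc z) = complex.Re z.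
Proof. by case: z. Qed.

Lemma cImJ z : complex.Im (conjc z) = - complex.Im z.
Proof. by case: z. Qed.

Lemma complex_ext z u :
  complex.Re z = complex.Re u -> complex.Im z = complex.Im u -> z = u.
Proof. by case: z u => [a b] [c e] /= -> ->. Qed.

Lemma mulc_conj z : z * conjc z = (abs2 z)%:C.
Proof. by apply: complex_ext; rewrite ?cReM ?cImM ?cReJ ?cImJ /= /abs2; ring. Qed.

Lemma conjcD z u : conjc (z + u) = conjc z + conjc u.
Proof. exact: rmorphD. Qed.

Lemma conjcM z u : conjc (z * u) = conjc z * conjc u.
Proof. exact: rmorphM. Qed.

Lemma conjc_sum (I : Type) (r : seq I) (p : pred I) (F : I -> R[i]) :
  conjc (\sum_(i <- r | p i) F i) = \sum_(i <- r | p i) conjc (F i).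
Proof. exact: rmorph_sum. Qed.

Lemma rcD (x y : R) : (x + y)%:C = x%:C + y%:C.
Proof. exact: rmorphD. Qed.

Lemma rcM (x y : R) : (x * y)%:C = x%:C * y%:C.
Proof. exact: rmorphM. Qed.

Lemma rc_sum (I : Type) (r : seq I) (p : pred I) (F : I -> R) :
  (\sum_(i <- r | p i) F i)%:C = \sum_(i <- r | p i) (F i)%:C.
Proof. exact: rmorph_sum. Qed.

Lemma abs2_ge0 z : 0 <= abs2 z.
Proof. by rewrite addr_ge0 ?sqr_ge0. Qed.

Lemma abs2_eq0 z : abs2 z = 0 -> z = 0.
Proof.
move=> /eqP; rewrite paddr_eq0 ?sqr_ge0// !sqrf_eq0 => /andP[/eqP r /eqP i].
by apply: complex_ext.
Qed.

End ComplexFacts.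

Section SquareIntegrable.
Context {R : realType} {d : measure_display} {Om : measurableType d}.
Variable P : probability Om R.
Implicit Types (X Y : Om -> R) (Z W : Om -> R[i]).

Definition rint X := P.-integrable setT (fun w => (X w)%:E).

Definition rexp X : R := fine 'E_P[X].

Lemma rintD X Y : rint X -> rint Y -> rint (fun w => X w + Y w).
Proof. by move=> iX iY; rewrite /rint; under eq_fun do rewrite EFinD; exact: integrableD. Qed.

Lemma rintZ (r : R) X : rint X -> rint (fun w => r * X w).
Proof. by move=> iX; rewrite /rint; under eq_fun do rewrite EFinM; exact: integrableZl. Qed.

Lemma rintN X : rint X -> rint (fun w => - X w).
Proof. by move=> iX; under eq_fun do rewrite -mulN1r; exact: rintZ. Qed.

Lemma rintB X Y : rint X -> rint Y -> rint (fun w => X w - Y w).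
Proof. by move=> iX iY; apply: rintD => //; exact: rintN. Qed.

Lemma rint_cst (r : R) : rint (fun=> r).
Proof. by apply: finite_measure_integrable_cst. Qed.

Lemma rexpD X Y : rint X -> rint Y -> rexp (fun w => X w + Y w) = rexp X + rexp Y.
Proof.
move=> iX iY; rewrite /rexp unlock.
by rewrite -fineD ?integrable_fin_num// -integralD_EFin.
Qed.

Lemma rexpZ (r : R) X : rint X -> rexp (fun w => r * X w) = r * rexp X.
Proof.
move=> iX; rewrite /rexp unlock.
under eq_integral do rewrite EFinM.
by rewrite integralZl// fineM ?integrable_fin_num.
Qed.

Lemma rexpN X : rint X -> rexp (fun w => - X w) = - rexp X.
Proof.
by move=> iX; rewrite -[RHS]mulN1r -rexpZ//; congr rexp; apply/funext => w; rewrite mulN1r.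
Qed.

Lemma rexpB X Y : rint X -> rint Y -> rexp (fun w => X w - Y w) = rexp X - rexp Y.
Proof. by move=> iX iY; rewrite rexpD ?rexpN//; exact: rintN. Qed.

Lemma rexp_cst (r : R) : rexp (fun=> r) = r.
Proof. by rewrite /rexp expectation_cst. Qed.

Lemma rexp_ge0 X : (forall w, 0 <= X w) -> 0 <= rexp X.
Proof. by move=> X0; rewrite /rexp fine_ge0// expectation_ge0. Qed.

Lemma rint_sum (I : Type) (r : seq I) (p : pred I) (X : I -> Om -> R) :
  (forall i, p i -> rint (X i)) -> rint (fun w => \sum_(i <- r | p i) X i w).
Proof.
move=> H; elim: r => [|i r IH].
  by under eq_fun do rewrite big_nil; exact: rint_cst.
case pi: (p i); under eq_fun do rewrite big_cons pi; last by [].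
by apply: rintD => //; exact: H.
Qed.

Lemma rexp_sum (I : Type) (r : seq I) (p : pred I) (X : I -> Om -> R) :
  (forall i, p i -> rint (X i)) ->
  rexp (fun w => \sum_(i <- r | p i) X i w) = \sum_(i <- r | p i) rexp (X i).
Proof.
move=> H; elim: r => [|i r IH].
  by under eq_fun do rewrite big_nil; rewrite big_nil rexp_cst.
rewrite big_cons; case pi: (p i); under eq_fun do rewrite big_cons pi; last by [].
by rewrite rexpD ?IH//; [exact: H|exact: rint_sum].
Qed.

Definition rL2 X := measurable_fun setT X /\ rint (fun w => X w ^+ 2).

Lemma le_rint X Y : measurable_fun setT X -> (forall w, `|X w| <= Y w) ->
  rint Y -> rint X.
Proof.
move=> mX XY iY; apply: (le_integrable measurableT _ _ iY).
  exact/measurable_EFinP.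
by move=> w _; rewrite lee_fin (le_trans (XY w))// ler_norm.
Qed.

Lemma rL2_mul X Y : rL2 X -> rL2 Y -> rint (fun w => X w * Y w).
Proof.
move=> [mX iX] [mY iY]; apply: (le_rint _ _ (rintD iX iY)).
  exact: measurable_funM.
move=> w; rewrite normrM -[X w ^+ 2]real_normK ?num_real//.
rewrite -[Y w ^+ 2]real_normK ?num_real//.
have := normr_ge0 (X w); have := normr_ge0 (Y w).
by move: `|X w| `|Y w| => x y x0 y0; have := sqr_ge0 (x - y); rewrite sqrrB; nra.
Qed.

Lemma rL2_cst (r : R) : rL2 (fun=> r).
Proof. by split => //; exact: rint_cst. Qed.

Lemma rL2_int X : rL2 X -> rint X.
Proof.
by move=> /rL2_mul/(_ (rL2_cst 1)); under [X in rint X -> _]eq_fun do rewrite mulr1.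
Qed.

Lemma rL2D X Y : rL2 X -> rL2 Y -> rL2 (fun w => X w + Y w).
Proof.
move=> HX HY; have [mX iX] := HX; have [mY iY] := HY.
split; first exact: measurable_funD.
have := rintD (rintD iX (rintZ 2 (rL2_mul HX HY))) iY; congr rint.
by apply/funext => w; ring.
Qed.

Lemma rL2Z (r : R) X : rL2 X -> rL2 (fun w => r * X w).
Proof.
move=> [mX iX]; split; first exact: measurable_funM.
by under eq_fun do rewrite exprMn; exact: rintZ.
Qed.

Lemma rL2N X : rL2 X -> rL2 (fun w => - X w).
Proof. by move=> iX; under eq_fun do rewrite -mulN1r; exact: rL2Z. Qed.

(** A product of two square-integrable variables is in general only integrable. The bounded factor,
    later a cosine or sine of a phase, keeps the product square-integrable. *)
Lemma rL2M_bounded X Y : measurable_fun setT X -> (forall w, `|X w| <= 1) ->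
  rL2 Y -> rL2 (fun w => X w * Y w).
Proof.
move=> mX X1 [mY iY]; split; first exact: measurable_funM.
apply: (le_rint _ _ iY); first by apply: measurable_funX; exact: measurable_funM.
move=> w; rewrite ger0_norm ?sqr_ge0// exprMn ler_piMl ?sqr_ge0//.
by rewrite -real_normK ?num_real// exprn_ile1.
Qed.

Definition cL2 Z :=
  rL2 (fun w => complex.Re (Z w)) /\ rL2 (fun w => complex.Im (Z w)).

Lemma cintegrableD Z W : cintegrable P Z -> cintegrable P W ->
  cintegrable P (fun w => Z w + W w).
Proof.
move=> [rZ iZ] [rW iW]; split; rewrite -/(rint _).
  by under eq_fun do rewrite cReD; exact: rintD.
by under eq_fun do rewrite cImD; exact: rintD.
Qed.

Lemma cintegrable_cst c : cintegrable P (fun=> c).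
Proof. by split; exact: rint_cst. Qed.

Lemma cintegrable_sum (I : Type) (r : seq I) (p : pred I) (Z : I -> Om -> R[i]) :
  (forall i, p i -> cintegrable P (Z i)) ->
  cintegrable P (fun w => \sum_(i <- r | p i) Z i w).
Proof.
move=> H; elim: r => [|i r IH].
  by under eq_fun do rewrite big_nil; exact: cintegrable_cst.
case pi: (p i); under eq_fun do rewrite big_cons pi; last by [].
by apply: cintegrableD => //; exact: H.
Qed.

Lemma cexpectE Z : cexpect P Z =
  rexp (fun w => complex.Re (Z w)) +i* rexp (fun w => complex.Im (Z w)).
Proof. by []. Qed.

Lemma cexpectD Z W : cintegrable P Z -> cintegrable P W ->
  cexpect P (fun w => Z w + W w) = cexpect P Z + cexpect P W.
Proof.
move=> [rZ iZ] [rW iW]; apply: complex_ext; rewrite !cexpectE ?cReD ?cImD /=.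
  by under eq_fun do rewrite cReD; exact: rexpD.
by under eq_fun do rewrite cImD; exact: rexpD.
Qed.

Lemma cexpectZ c Z : cintegrable P Z ->
  cexpect P (fun w => c * Z w) = c * cexpect P Z.
Proof.
move=> [rZ iZ]; apply: complex_ext; rewrite !cexpectE ?cReM ?cImM /=.
  by under eq_fun do rewrite cReM; rewrite rexpB ?rexpZ//; exact: rintZ.
by under eq_fun do rewrite cImM; rewrite rexpD ?rexpZ//; exact: rintZ.
Qed.

Lemma cexpect_cst c : cexpect P (fun=> c) = c.
Proof. by rewrite cexpectE !rexp_cst; case: c. Qed.

Lemma cexpect_sum (I : Type) (r : seq I) (p : pred I) (Z : I -> Om -> R[i]) :
  (forall i, p i -> cintegrable P (Z i)) ->
  cexpect P (fun w => \sum_(i <- r | p i) Z i w) =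
  \sum_(i <- r | p i) cexpect P (Z i).
Proof.
move=> H; elim: r => [|i r IH].
  by under eq_fun do rewrite big_nil; rewrite big_nil cexpect_cst.
rewrite big_cons; case pi: (p i); under eq_fun do rewrite big_cons pi; last by [].
by rewrite cexpectD ?IH//; [exact: H|exact: cintegrable_sum].
Qed.

Lemma cexpect_conj Z : cintegrable P Z ->
  cexpect P (fun w => conjc (Z w)) = conjc (cexpect P Z).
Proof.
move=> [rZ iZ]; apply: complex_ext; rewrite ?cReJ ?cImJ !cexpectE /=.
  by under eq_fun do rewrite cReJ.
by under eq_fun do rewrite cImJ; rewrite rexpN.
Qed.

Lemma cL2D Z W : cL2 Z -> cL2 W -> cL2 (fun w => Z w + W w).
Proof.
move=> [rZ iZ] [rW iW]; split.
  by under eq_fun do rewrite cReD; exact: rL2D.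
by under eq_fun do rewrite cImD; exact: rL2D.
Qed.

Lemma cL2Z c Z : cL2 Z -> cL2 (fun w => c * Z w).
Proof.
move=> [rZ iZ]; split.
  under eq_fun do rewrite cReM.
  by apply: rL2D; [|under eq_fun do rewrite -mulNr]; exact: rL2Z.
by under eq_fun do rewrite cImM; apply: rL2D; exact: rL2Z.
Qed.

Lemma cL2_cst c : cL2 (fun=> c).
Proof. by split; exact: rL2_cst. Qed.

Lemma cL2N Z : cL2 Z -> cL2 (fun w => - Z w).
Proof. by move=> HZ; under eq_fun do rewrite -mulN1r; exact: cL2Z. Qed.

Lemma cL2B Z W : cL2 Z -> cL2 W -> cL2 (fun w => Z w - W w).
Proof. by move=> HZ HW; apply: cL2D => //; exact: cL2N. Qed.

Lemma cL2_conj Z : cL2 Z -> cL2 (fun w => conjc (Z w)).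
Proof.
move=> [rZ iZ]; split; first by under eq_fun do rewrite cReJ.
by under eq_fun do rewrite cImJ; exact: rL2N.
Qed.

Lemma cL2_sum (I : Type) (r : seq I) (p : pred I) (Z : I -> Om -> R[i]) :
  (forall i, p i -> cL2 (Z i)) -> cL2 (fun w => \sum_(i <- r | p i) Z i w).
Proof.
move=> H; elim: r => [|i r IH].
  by under eq_fun do rewrite big_nil; exact: cL2_cst.
case pi: (p i); under eq_fun do rewrite big_cons pi; last by [].
by apply: cL2D => //; exact: H.
Qed.

Lemma cL2M_bounded Z W : measurable_crv Z -> (forall w, abs2 (Z w) <= 1) ->
  cL2 W -> cL2 (fun w => Z w * W w).
Proof.
move=> [mr mi] Z1 [rW iW].
have r1 w : `|complex.Re (Z w)| <= 1.
  rewrite -ler_sqr ?nnegrE// real_normK ?num_real// expr1n.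
  by apply: le_trans (Z1 w); rewrite lerDl sqr_ge0.
have i1 w : `|complex.Im (Z w)| <= 1.
  rewrite -ler_sqr ?nnegrE// real_normK ?num_real// expr1n.
  by apply: le_trans (Z1 w); rewrite lerDr sqr_ge0.
split.
  under eq_fun do rewrite cReM; apply: rL2D; first exact: rL2M_bounded.
  by apply: rL2N; exact: rL2M_bounded.
by under eq_fun do rewrite cImM; apply: rL2D; exact: rL2M_bounded.
Qed.

Lemma cL2_mul Z W : cL2 Z -> cL2 W -> cintegrable P (fun w => Z w * W w).
Proof.
move=> [rZ iZ] [rW iW]; split; rewrite -/(rint _).
  by under eq_fun do rewrite cReM; apply: rintB; exact: rL2_mul.
by under eq_fun do rewrite cImM; apply: rintD; exact: rL2_mul.
Qed.

Lemma cL2_int Z : cL2 Z -> cintegrable P Z.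
Proof. by move=> [rZ iZ]; split; exact: rL2_int. Qed.

(** The L2 inner product, linear in [Z] and conjugate-linear in [W]; for centered variables it is
    the covariance. *)
Definition ip Z W := cexpect P (fun w => Z w * conjc (W w)).

Lemma ip_int Z W : cL2 Z -> cL2 W -> cintegrable P (fun w => Z w * conjc (W w)).
Proof. by move=> HZ HW; apply: cL2_mul => //; exact: cL2_conj. Qed.

Lemma ipC Z W : cL2 Z -> cL2 W -> ip W Z = conjc (ip Z W).
Proof.
move=> HZ HW; rewrite /ip -cexpect_conj; last exact: ip_int.
by congr cexpect; apply/funext => w; rewrite conjcM conjcK mulrC.
Qed.

Lemma ipDl Z1 Z2 W : cL2 Z1 -> cL2 Z2 -> cL2 W ->
  ip (fun w => Z1 w + Z2 w) W = ip Z1 W + ip Z2 W.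
Proof.
move=> H1 H2 HW; rewrite /ip -cexpectD; try exact: ip_int.
by congr cexpect; apply/funext => w; rewrite mulrDl.
Qed.

Lemma ipZl c Z W : cL2 Z -> cL2 W -> ip (fun w => c * Z w) W = c * ip Z W.
Proof.
move=> HZ HW; rewrite /ip -cexpectZ; last exact: ip_int.
by congr cexpect; apply/funext => w; rewrite mulrA.
Qed.

Lemma ip_suml (I : Type) (r : seq I) (p : pred I) (Z : I -> Om -> R[i]) W :
  (forall i, p i -> cL2 (Z i)) -> cL2 W ->
  ip (fun w => \sum_(i <- r | p i) Z i w) W = \sum_(i <- r | p i) ip (Z i) W.
Proof.
move=> H HW; rewrite /ip -cexpect_sum; last by move=> i /H ?; exact: ip_int.
by congr cexpect; apply/funext => w; rewrite mulr_suml.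
Qed.

Lemma ipDr Z W1 W2 : cL2 Z -> cL2 W1 -> cL2 W2 ->
  ip Z (fun w => W1 w + W2 w) = ip Z W1 + ip Z W2.
Proof.
move=> HZ H1 H2; rewrite ipC ?ipDl ?conjcD//; last exact: cL2D.
by rewrite -!ipC.
Qed.

Lemma ipZr c Z W : cL2 Z -> cL2 W -> ip Z (fun w => c * W w) = conjc c * ip Z W.
Proof.
move=> HZ HW; rewrite ipC ?ipZl ?conjcM//; last exact: cL2Z.
by rewrite -ipC.
Qed.

Lemma ip_sumr (I : Type) (r : seq I) (p : pred I) Z (W : I -> Om -> R[i]) :
  cL2 Z -> (forall i, p i -> cL2 (W i)) ->
  ip Z (fun w => \sum_(i <- r | p i) W i w) = \sum_(i <- r | p i) ip Z (W i).
Proof.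
move=> HZ H; rewrite ipC ?ip_suml//; last exact: cL2_sum.
by rewrite conjc_sum; apply: eq_bigr => i pi; rewrite -ipC//; exact: H.
Qed.

Lemma rint_abs2 Z : cL2 Z -> rint (fun w => abs2 (Z w)).
Proof. by move=> [[_ rZ] [_ iZ]]; exact: rintD. Qed.

Lemma ipZZ Z : ip Z Z = (rexp (fun w => abs2 (Z w)))%:C.
Proof.
rewrite /ip; under eq_fun do rewrite mulc_conj.
by rewrite cexpectE /= rexp_cst.
Qed.

End SquareIntegrable.

(** * The orthogonality principle for linear estimators *)

Section LMMSE.
Context {R : realType} {d : measure_display} {Om : measurableType d}.
Variables (P : probability Om R) (m q : nat).
Variables (g : Om -> 'cV[R[i]]_m) (psi : Om -> 'cV[R[i]]_q) (A0 : 'M[R[i]]_(m, q)).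
Hypothesis g2 : forall a, cL2 P (fun w => g w a 0).
Hypothesis psi2 : forall b, cL2 P (fun w => psi w b 0).

Let err (A : 'M[R[i]]_(m, q)) a w := (g w - A *m psi w) a 0.

Lemma cL2_mulmx p (D : 'M[R[i]]_(p, q)) a : cL2 P (fun w => (D *m psi w) a 0).
Proof.
under eq_fun do rewrite mxE; apply: cL2_sum => b _; exact: cL2Z.
Qed.

Lemma cL2_err A a : cL2 P (err A a).
Proof.
by rewrite /err; under eq_fun do rewrite mxE [X in _ + X]mxE;
  apply: cL2B => //; exact: cL2_mulmx.
Qed.

(** Square integrability makes the error finite for every [A], so the minimisation in [\bar R]
    becomes a comparison of real sums. *)
Lemma mseE A : mse P g (fun w => A *m psi w) =
  (\sum_(a < m) rexp P (fun w => abs2 (err A a w)))%:E.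
Proof.
have i a : true -> rint P (fun w => abs2 (err A a w)).
  by move=> _; apply: rint_abs2; exact: cL2_err.
rewrite -rexp_sum// /rexp fineK// unlock.
by apply: integrable_fin_num => //; exact: rint_sum.
Qed.

Hypothesis orth : forall a b, ip P (err A0 a) (fun w => psi w b 0) = 0.
Hypothesis definite : forall D : 'rV[R[i]]_q,
  rexp P (fun w => abs2 ((D *m psi w) 0 0)) = 0 -> D = 0.

(** Row by row, err A = err A0 + (A0 - A) psi, and the second summand is a linear combination of
    coordinates of [psi], to which err A0 is orthogonal. *)
Lemma pythagoras A a : rexp P (fun w => abs2 (err A a w)) =
  rexp P (fun w => abs2 (err A0 a w)) +
  rexp P (fun w => abs2 ((row a (A0 - A) *m psi w) 0 0)).
Proof.
apply: complexI; rewrite rcD -!ipZZ.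
pose D := row a (A0 - A).
have H2 : cL2 P (fun w => (D *m psi w) 0 0) by exact: cL2_mulmx.
have H1 := cL2_err A0 a.
have o1 : ip P (err A0 a) (fun w => (D *m psi w) 0 0) = 0.
  under [X in ip _ _ X]eq_fun do rewrite mxE.
  rewrite ip_sumr//; last by move=> b _; exact: cL2Z.
  by apply: big1 => b _; rewrite ipZr// orth mulr0.
have o2 : ip P (fun w => (D *m psi w) 0 0) (err A0 a) = 0.
  by rewrite ipC// o1 conjc0.
have -> : err A a = fun w => err A0 a w + (D *m psi w) 0 0.
  apply/funext => w.
  have -> : (D *m psi w) 0 0 = (A0 *m psi w) a 0 - (A *m psi w) a 0.
    by rewrite /D -row_mul mxE mulmxBl [LHS]mxE [X in _ + X]mxE.
  by rewrite /err ![(_ - _ : 'cV_m) a 0]mxE ![(- _ : 'cV_m) a 0]mxE addrA subrK.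
have H3 := cL2D H1 H2.
by rewrite ipDl// !ipDr// o1 o2 addr0 add0r.
Qed.

Lemma is_LMMSE_orthogonal (g0 : mx_expect P g = 0) (psi0 : mx_expect P psi = 0)
    (ghat : Om -> 'cV[R[i]]_m) :
  is_LMMSE P g psi ghat <-> ghat = fun w => A0 *m psi w.
Proof.
have zg : zero_mean P g.
  by split => // a b; rewrite (ord1 b); exact/cL2_int.
have zpsi : zero_mean P psi.
  by split => // a b; rewrite (ord1 b); exact/cL2_int.
split=> [[_ _ [A -> /(_ A0)]]|->].
  (* Comparing an optimal [A] with [A0] leaves a sum of nonnegative excess terms that is at most 0;
     each vanishes, and [definite] then kills every row of A0 - A. *)
  rewrite !mseE lee_fin; under eq_bigr do rewrite pythagoras.
  rewrite big_split/= gerDl => le0.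
  suff -> : A0 = A by [].
  apply/row_matrixP => a; apply/eqP; rewrite -subr_eq0 -linearB/=; apply/eqP.
  apply: definite; apply/eqP.
  have ge0 i : true -> 0 <= rexp P (fun w => abs2 ((row i (A0 - A) *m psi w) 0 0)).
    by move=> _; apply: rexp_ge0 => w; exact: abs2_ge0.
  have /eqP : \sum_(a < m) rexp P (fun w => abs2 ((row a (A0 - A) *m psi w) 0 0)) = 0.
    by apply/eqP; rewrite eq_le le0 sumr_ge0.
  by rewrite psumr_eq0// => /allP/(_ a (mem_index_enum a)).
split => //; exists A0 => // A; rewrite !mseE lee_fin.
apply: ler_sum => a _; rewrite [leRHS]pythagoras lerDl.
by apply: rexp_ge0 => w; exact: abs2_ge0.
Qed.

End LMMSE.

(** * Positive definiteness of the pilot covariance *)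

Section QuadraticForms.
Context {R : realType}.

(** The form v M v^H with [v] as a row: when M i j = E[z_i z_j^*] it is the second moment of sum_i
    v_i z_i, which is why the unconjugated factor stands on the left. *)
Definition qform n (M : 'M[R[i]]_n) (v : 'I_n -> R[i]) : R[i] :=
  \sum_i \sum_j v i * M i j * conjc (v j).

Lemma qformD n (M1 M2 : 'M[R[i]]_n) v : qform (M1 + M2) v = qform M1 v + qform M2 v.
Proof.
rewrite /qform -big_split; apply: eq_bigr => i _; rewrite -big_split.
by apply: eq_bigr => j _; rewrite /= mxE mulrDr mulrDl.
Qed.

Lemma qformZ n c (M : 'M[R[i]]_n) v : qform (c *: M) v = c * qform M v.
Proof.
rewrite /qform mulr_sumr; apply: eq_bigr => i _; rewrite mulr_sumr.
by apply: eq_bigr => j _; rewrite mxE mulrCA -!mulrA.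
Qed.

Lemma qform_sum n (I : Type) (r : seq I) (M : I -> 'M[R[i]]_n) v :
  qform (\sum_(a <- r) M a) v = \sum_(a <- r) qform (M a) v.
Proof.
elim: r => [|a r IH]; last by rewrite !big_cons qformD IH.
rewrite !big_nil /qform big1// => i _; rewrite big1// => j _.
by rewrite mxE mulr0 mul0r.
Qed.

Lemma qform_scalar n (c : R[i]) v :
  qform (c%:M : 'M[R[i]]_n) v = c * (\sum_i abs2 (v i))%:C.
Proof.
rewrite /qform rc_sum mulr_sumr; apply: eq_bigr => i _ /=.
rewrite (bigD1 i)//= big1 ?addr0.
  by rewrite mxE eqxx mulr1n mulrC mulrA [conjc _ * _]mulrC mulc_conj mulrC.
by move=> j ji; rewrite mxE eq_sym (negPf ji) mulr0n mulr0 mul0r.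
Qed.

(* Since c_s >= 0, this exhibits the AR(1) correlation matrix as a Gram matrix; c_s
   is the increment of exp(2as). *)
Lemma sum_exp_increments (a : R) n (i j : 'I_n) :
  let c s := if s is s'.+1 then expR (a * 2 * s%:R) - expR (a * 2 * s'%:R) else 1 in
  expR (- a * `|i%:R - j%:R|) =
  \sum_(s < n) c s * (expR (- (a * i%:R)) *+ (s <= i)%N) *
                     (expR (- (a * j%:R)) *+ (s <= j)%N).
Proof.
move=> c.
have tele m : \sum_(0 <= s < m.+1) c s = expR (a * 2 * m%:R).
  elim: m => [|m IH]; first by rewrite big_nat1 mulr0 expR0.
  by rewrite big_nat_recr//= IH addrC subrK.
(* The conditions s <= i and s <= j select s <= min(i, j), where the increments telescope to exp(2 a
   min(i, j)); moreover 2 min(i, j) - i - j = -|i - j|. *)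
pose m := minn i j.
have mn : (m < n)%N by rewrite (leq_ltn_trans (geq_minl _ _)).
transitivity (expR (- (a * i%:R)) * expR (- (a * j%:R)) *
   \sum_(0 <= s < n | (s < m.+1)%N) c s); last first.
  rewrite big_mkord mulr_sumr [LHS]big_mkcond; apply: eq_bigr => s _.
  rewrite ltnS leq_min; case: (s <= i)%N; case: (s <= j)%N => /=;
    by rewrite ?mulr1n ?mulr0n ?mulr0 ?mul0r//; ring.
have -> : \sum_(0 <= s < n | (s < m.+1)%N) c s = \sum_(0 <= s < m.+1) c s.
  by rewrite [RHS](big_nat_widen _ _ n).
rewrite tele -!expRD; congr expR; rewrite /m.
have [ij|/ltnW ij] := leqP i j.
  rewrite ler0_norm ?subr_le0 ?ler_nat//; ring.
rewrite ger0_norm ?subr_ge0 ?ler_nat//; ring.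
Qed.

Lemma qform_exp_ge0 (a : R) n (v : 'I_n -> R[i]) : 0 <= a ->
  0 <= qform (\matrix_(i, j) (expR (- a * `|i%:R - j%:R|))%:C) v.
Proof.
move=> a0; pose c s : R :=
  if s is s'.+1 then expR (a * 2 * s%:R) - expR (a * 2 * s'%:R) else 1.
have c0 s : 0 <= c s.
  case: s => [|s]; rewrite /c ?ler01// subr_ge0 ler_expR ler_wpM2l ?ler_nat//.
  by rewrite mulr_ge0.
(* The factors of the Gram decomposition: the form becomes a sum of squared moduli with the
   nonnegative weights [c s]. *)
pose u (s : 'I_n) (i : 'I_n) : R := expR (- (a * i%:R)) *+ (s <= i)%N.
suff -> : qform (\matrix_(i, j) (expR (- a * `|i%:R - j%:R|))%:C) v =
  (\sum_(s < n) c s * abs2 (\sum_i v i * (u s i)%:C))%:C.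
  by rewrite ler0c sumr_ge0// => s _; rewrite mulr_ge0 ?abs2_ge0.
rewrite rc_sum /qform /=.
under eq_bigr => i _.
  under eq_bigr => j _.
    rewrite mxE sum_exp_increments rc_sum mulr_sumr mulr_suml.
    over.
  rewrite exchange_big.
  over.
rewrite exchange_big; apply: eq_bigr => s _.
rewrite rcM -mulc_conj conjc_sum mulr_suml mulr_sumr; apply: eq_bigr => i _.
rewrite mulr_sumr mulr_sumr; apply: eq_bigr => j _.
rewrite conjcM conjc_real !rcM -/(c s) -/(u s i) -/(u s j).
ring.
Qed.

Lemma rowvec_qform n (M : 'M[R[i]]_n) (v : 'rV[R[i]]_n) :
  v *m M = 0 -> qform M (v 0) = 0.
Proof.
move=> vM; rewrite /qform exchange_big big1// => j _; rewrite -mulr_suml.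
by have /matrixP/(_ 0 j) := vM; rewrite !mxE => ->; rewrite mul0r.
Qed.

End QuadraticForms.

Section PilotCovariance.
Context {R : realType} {d : measure_display} {Om : measurableType d}.
Context {L N K B : nat}.
Variables (P : probability Om R) (T : nat) (S : uplink R Om L N K B).
Hypothesis hS : uplink_model P T S.

(** [X_mx] is the AR(1) correlation matrix multiplied entrywise by x x^H, plus kappa^2 times the
    diagonal of the |x_i|^2. The pilot symbols are absorbed into the vector. *)
Lemma qform_X_mx_ge0 l m v : 0 <= qform (X_mx S l m) v.
Proof.
have -> : qform (X_mx S l m) v =
    qform (\matrix_(i, j) (expR (- (delta S / 2) * `|i%:R - j%:R|))%:C)
      (fun i => v i * pilot S l m i 0) +
    (kappa S ^+ 2 * \sum_i abs2 (v i * pilot S l m i 0))%:C.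
  rewrite rcM rc_sum mulr_sumr /qform -big_split; apply: eq_bigr => i _ /=.
  rewrite (bigD1 i)//= [in RHS](bigD1 i)//= !mxE eqxx subrr normr0 mulr0 expR0.
  rewrite -addrA [X in _ = _ + X]addrC addrA; congr (_ + _).
    by rewrite rcM -!mulc_conj conjcM rcD; ring.
  apply: eq_bigr => j ji; rewrite !mxE eq_sym (negPf ji) conjcM; ring.
rewrite addr_ge0//; first by rewrite qform_exp_ge0// divr_ge0// (delta_ge0 hS).
rewrite ler0c mulr_ge0 ?sqr_ge0// sumr_ge0// => i _; exact: abs2_ge0.
Qed.

(** The receiver noise supplies the strict part of positive definiteness; the pilot terms are only
    semidefinite. *)
Lemma qform_Psi_mx_ge j v :
  (sigma S ^+ 2 * xi S * \sum_i abs2 (v i))%:C <= qform (Psi_mx S j) v.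
Proof.
rewrite /Psi_mx qformD qform_scalar rcM lerDr.
rewrite qform_sum sumr_ge0// => l _; rewrite qform_sum sumr_ge0// => m _.
by rewrite qformZ mulr_ge0 ?qform_X_mx_ge0// ler0c ltW// (lambda_gt0 hS).
Qed.

Lemma noise_power_gt0 : 0 < sigma S ^+ 2 * xi S.
Proof.
by rewrite mulr_gt0 ?(sigma2_gt0 hS)// (lt_le_trans ltr01 (xi_ge1 hS)).
Qed.

Lemma qform_Psi_mx_eq0 j v : qform (Psi_mx S j) v = 0 -> forall i, v i = 0.
Proof.
move=> q0 i; have := qform_Psi_mx_ge j v; rewrite q0 lecR => le0.
have : \sum_i abs2 (v i) <= 0 by move: le0; rewrite pmulr_rle0// noise_power_gt0.
have s0 : 0 <= \sum_i abs2 (v i) by rewrite sumr_ge0// => k _; exact: abs2_ge0.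
move=> le0'; have /eqP : \sum_i abs2 (v i) = 0 by apply/eqP; rewrite eq_le le0'.
rewrite psumr_eq0; last by move=> k _; exact: abs2_ge0.
by move=> /allP/(_ i (mem_index_enum i))/eqP/abs2_eq0.
Qed.

Lemma Psi_mx_unit j : Psi_mx S j \in unitmx.
Proof.
rewrite -row_free_unit -kermx_eq0; apply/rowV0P => v /sub_kermxP/rowvec_qform q0.
by apply/rowP => i; rewrite mxE; exact: (qform_Psi_mx_eq0 q0).
Qed.

End PilotCovariance.

(** * Complex normal vectors and variance mixtures *)

Section SigmaMeasurability.
Context {R : realType} {d : measure_display} {Om : measurableType d}.
Implicit Types (A G : set (set Om)) (X : Om -> R).

Definition reim (b : bool) (z : R[i]) : R := if b then complex.Im z else complex.Re z.

(** Measurability with respect to an arbitrary family of sets, so that several generated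
    sigma-algebras can coexist on [Om]. [meas_comp] and [measP] translate to and from
    [measurable_fun]. *)
Definition meas A X := forall U : set R, measurable U -> A (X @^-1` U).

Lemma meas_sigma_real (I : Type) (D : set I) (X : I -> Om -> R) i :
  D i -> meas (sigma_real D X) (X i).
Proof.
move=> Di U mU; apply: sub_sigma_algebra; exists i => //.
by exists U => //; rewrite setTI.
Qed.

Lemma meas_sigma_cplx (I : Type) (Z : I -> Om -> R[i]) i b :
  meas (sigma_cplx Z) (fun w => reim b (Z i w)).
Proof.
exact: (@meas_sigma_real (I * bool) setT
  (fun q w => if q.2 then complex.Im (Z q.1 w) else complex.Re (Z q.1 w)) (i, b)).
Qed.

Lemma sigma_real_measurable (I : Type) (D : set I) (X : I -> Om -> R) :
  (forall i, D i -> measurable_fun setT (X i)) ->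
  forall E, sigma_real D X E -> measurable E.
Proof.
move=> mX; apply: smallest_sub; first exact: sigma_algebra_measurable.
by move=> _ [i Di [U mU <-]]; exact: mX.
Qed.

Lemma measurable_crvP (z : Om -> R[i]) : measurable_crv z ->
  forall b, measurable_fun setT (fun w => reim b (z w)).
Proof. by move=> [mr mi] []. Qed.

Lemma sigma_cplx_measurable (I : Type) (Z : I -> Om -> R[i]) :
  (forall i, measurable_crv (Z i)) ->
  forall E, sigma_cplx Z E -> measurable E.
Proof.
move=> mZ; apply: sigma_real_measurable => -[i b] _ /=.
exact: (measurable_crvP (mZ i) b).
Qed.

Lemma meas_comp (G : set (set Om)) (X : Om -> R) :
  measurable_fun [set: g_sigma_algebraType G] X -> meas <<s G >> X.
Proof. by move=> mX U mU; rewrite -[_ @^-1` _]setTI; exact: mX. Qed.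

Lemma measP (G : set (set Om)) (X : Om -> R) :
  meas <<s G >> X -> measurable_fun [set: g_sigma_algebraType G] X.
Proof. by move=> mX _ U mU; rewrite setTI; exact: mX. Qed.

Lemma sigma_algebraT (G : set (set Om)) : <<s G >> setT.
Proof. exact: (@measurableT _ (g_sigma_algebraType G)). Qed.

Lemma sigma_algebraI (G : set (set Om)) E F : <<s G >> E -> <<s G >> F -> <<s G >> (E `&` F).
Proof. exact: (@measurableI _ (g_sigma_algebraType G)). Qed.

Lemma meas_cst (G : set (set Om)) (r : R) : meas <<s G >> (fun=> r).
Proof. by apply: meas_comp; exact: measurable_cst. Qed.

End SigmaMeasurability.

Section IndependenceComplex.
Context {R : realType} {d : measure_display} {Om : measurableType d}.
Variable P : probability Om R.

Lemma indep_rv_sigma (A1 A2 : set (set Om)) (X Y : Om -> R) :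
  independent2 P A1 A2 -> meas A1 X -> meas A2 Y -> indep_rv P X Y.
Proof. by move=> ind mX mY U V mU mV; apply: ind; [exact: mX|exact: mY]. Qed.

Lemma cexpect_indep (Z W : Om -> R[i]) :
  (forall b b', indep_rv P (fun w => reim b (Z w)) (fun w => reim b' (W w))) ->
  cintegrable P Z -> cintegrable P W ->
  cintegrable P (fun w => Z w * W w) /\
  cexpect P (fun w => Z w * W w) = cexpect P Z * cexpect P W.
Proof.
move=> ind [rZ iZ] [rW iW].
have [irr err] := expectation_indep_mul rZ rW (ind false false).
have [iri eri] := expectation_indep_mul rZ iW (ind false true).
have [iir eir] := expectation_indep_mul iZ rW (ind true false).
have [iii eii] := expectation_indep_mul iZ iW (ind true true).
split.
  split; rewrite -/(rint _ _).
    by under eq_fun do rewrite cReM; exact: rintB.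
  by under eq_fun do rewrite cImM; exact: rintD.
apply: complex_ext; rewrite !cexpectE ?cReM ?cImM /=.
  by under eq_fun do rewrite cReM; rewrite rexpB// /rexp err eii.
by under eq_fun do rewrite cImM; rewrite rexpD// /rexp eri eir.
Qed.

Lemma mutually_independent2 (I : finType) (A : I -> set (set Om)) i1 i2 (X Y : Om -> R) :
  mutually_independent P A -> (forall i, A i setT) -> i1 != i2 ->
  measurable_fun setT X -> measurable_fun setT Y ->
  meas (A i1) X -> meas (A i2) Y -> indep_rv P X Y.
Proof.
move=> ind AT i12 mX mY aX aY U V mU mV.
have mXU : measurable (X @^-1` U) by rewrite -[_ @^-1` _]setTI; exact: mX.
have mYV : measurable (Y @^-1` V) by rewrite -[_ @^-1` _]setTI; exact: mY.
(* All other events are [setT], which reduces the product rule to two factors. *)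
pose E i := if i == i1 then X @^-1` U else if i == i2 then Y @^-1` V else setT.
have AE i : A i (E i).
  rewrite /E; case: eqVneq => [->|_]; first exact: aX.
  by case: eqVneq => [->|_]; [exact: aY|exact: AT].
have := ind E AE.
have -> : \bigcap_(i in [set: I]) E i = X @^-1` U `&` Y @^-1` V.
  apply/seteqP; split => [w Hw|w [HX HY] i _].
    split; first by have := Hw i1 Logic.I; rewrite /E eqxx.
    by have := Hw i2 Logic.I; rewrite /E eq_sym (negPf i12) eqxx.
  by rewrite /E; case: ifP => // _; case: ifP.
rewrite (bigD1 i1)//= (bigD1 i2)/= 1?eq_sym// big1 => [|i /andP[ii1 ii2]]; last first.
  by rewrite /E (negPf ii1) (negPf ii2) probability_setT.
rewrite /E eqxx eq_sym (negPf i12) eqxx mulr1 => H.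
rewrite -[LHS]fineK ?fin_num_measure//; last exact: measurableI.
by rewrite H EFinM !fineK ?fin_num_measure.
Qed.

Lemma rexp_sym_eq0 (X : Om -> R) : measurable_fun setT X -> rint P X ->
  (forall V : set R, measurable V -> P (X @^-1` V) = P (X @^-1` (-%R @^-1` V))) ->
  rexp P X = 0.
Proof.
move=> mX iX sym.
(* The companion variable is constant and the weight is 1, so only the law of [X] is involved. *)
have := @expectation_odd_eq0 _ _ _ P _ (measurableTypeR R) (fun=> 0) X (fun=> 1).
under [X in _ -> fine 'E_P[X] = _]eq_fun do rewrite mul1r.
apply => //; last by under eq_fun do rewrite mul1r.
move=> A V mA mV; rewrite preimage_cst; case: ifP => _; last by rewrite !set0I.
by rewrite !setTI; exact: sym.
Qed.

Lemma indep_rvN (X Y : Om -> R) : indep_rv P X Y -> indep_rv P X (fun w => - Y w).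
Proof.
move=> ind U V mU mV; apply: (ind U (-%R @^-1` V)) => //.
by rewrite -[_ @^-1` _]setTI; exact: (@oppr_measurable R setT).
Qed.

Lemma ip_indep (Z W : Om -> R[i]) :
  (forall b b', indep_rv P (fun w => reim b (Z w)) (fun w => reim b' (W w))) ->
  cL2 P Z -> cL2 P W -> ip P Z W = cexpect P Z * conjc (cexpect P W).
Proof.
move=> ind Z2 W2; rewrite -cexpect_conj; last exact: cL2_int.
apply: (cexpect_indep _ _ _).2; [|exact: cL2_int|exact/cL2_int/cL2_conj].
move=> b [].
  rewrite (_ : (fun w => reim true (conjc (W w))) = (fun w => - reim true (W w))).
    exact/indep_rvN/ind.
  by apply/funext => w; rewrite /reim cImJ.
rewrite (_ : (fun w => reim false (conjc (W w))) = (fun w => reim false (W w))).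
  exact: ind.
by apply/funext => w; rewrite /reim cReJ.
Qed.

(* Expanding c h x^* into real and imaginary parts, every term is odd in x. *)
Lemma ip_odd (c h x : Om -> R[i]) :
  measurable_crv c -> (forall w, abs2 (c w) <= 1) -> cL2 P h -> cL2 P x ->
  (forall b1 b2 b3 (U1 U2 V : set R), measurable U1 -> measurable U2 -> measurable V ->
    P ((fun w => reim b1 (c w)) @^-1` U1 `&` (fun w => reim b2 (h w)) @^-1` U2 `&`
       (fun w => reim b3 (x w)) @^-1` V) =
    P ((fun w => reim b1 (c w)) @^-1` U1 `&` (fun w => reim b2 (h w)) @^-1` U2 `&`
       (fun w => reim b3 (x w)) @^-1` (-%R @^-1` V))) ->
  ip P (fun w => c w * h w) x = 0.
Proof.
move=> mc c1 h2 x2 sym.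
have mcb := measurable_crvP mc.
have hb b : rL2 P (fun w => reim b (h w)) by case: b; case: h2.
have xb b : rL2 P (fun w => reim b (x w)) by case: b; case: x2.
have cb b w : `|reim b (c w)| <= 1.
  rewrite -ler_sqr ?nnegrE// real_normK ?num_real// expr1n.
  by apply: le_trans (c1 w); case: b; rewrite /= ?lerDl ?lerDr sqr_ge0.
have int b1 b2 b3 : rint P (fun w => reim b1 (c w) * reim b2 (h w) * reim b3 (x w)).
  by apply: rL2_mul => //; apply: rL2M_bounded.
have zero b1 b2 b3 : rexp P (fun w => reim b1 (c w) * reim b2 (h w) * reim b3 (x w)) = 0.
  apply: expectation_odd3_eq0 => //; try exact: mcb.
  - by case: (hb b2).
  - by case: (xb b3).
  - exact: sym.
  - exact: int.
apply: complex_ext; rewrite /ip cexpectE /=.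
  rewrite (_ : (fun w => _) = (fun w =>
     (reim false (c w) * reim false (h w) * reim false (x w) -
      reim true (c w) * reim true (h w) * reim false (x w)) +
     (reim false (c w) * reim true (h w) * reim true (x w) +
      reim true (c w) * reim false (h w) * reim true (x w)))).
    by rewrite rexpD ?rexpB ?rexpD ?zero ?subr0 ?addr0//; [exact: rintB|exact: rintD].
  by apply/funext => w; rewrite !cReM cImM cReJ cImJ /=; ring.
rewrite (_ : (fun w => _) = (fun w =>
     (reim true (c w) * reim true (h w) * reim true (x w) -
      reim false (c w) * reim false (h w) * reim true (x w)) +
     (reim false (c w) * reim true (h w) * reim false (x w) +
      reim true (c w) * reim false (h w) * reim false (x w)))).
  by rewrite rexpD ?rexpB ?rexpD ?zero ?subr0 ?addr0//; [exact: rintB|exact: rintD].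
by apply/funext => w; rewrite !cImM cReM cReJ cImJ /=; ring.
Qed.

End IndependenceComplex.

(** * Complex normal vectors with random variances *)

Section ComplexNormalMixture.
Context {R : realType} {d : measure_display} {Om : measurableType d}.
Context {I : finType}.
Implicit Types (W : I * bool -> set R) (Z : I -> Om -> R[i]).

(* The real coordinates of Z are indexed by I * bool: (i, false) is the real
   part of Z i and (i, true) its imaginary part. *)
Definition box_event Z W : set Om :=
  rect_event Z (fun i => W (i, false)) (fun i => W (i, true)).

Definition box_mass (v : I -> R) W : R :=
  CN_mass v (fun i => W (i, false)) (fun i => W (i, true)).

Lemma box_eventE Z W :
  box_event Z W = [set w | forall q, W q (reim q.2 (Z q.1 w))].
Proof.
apply/seteqP; split => w /= H; first by move=> [i []]; have [] := H i.
by move=> i; split; [exact: (H (i, false))|exact: (H (i, true))].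
Qed.

Definition flip (q0 : I * bool) W q : set R := if q == q0 then -%R @^-1` W q else W q.

Lemma measurable_oppr_preimage (V : set R) : measurable V -> measurable (-%R @^-1` V : set R).
Proof. by move=> mV; rewrite -[_ @^-1` _]setTI; exact: (@oppr_measurable R setT). Qed.

Lemma box_mass_flip v W q0 : (forall i, 0 <= v i) -> (forall q, measurable (W q)) ->
  box_mass v (flip q0 W) = box_mass v W.
Proof.
move=> v0 mW; apply: eq_bigr => i _.
by congr (fine _ * fine _); rewrite /flip; case: ifP => // _;
  rewrite centered_normalN// divr_ge0.
Qed.

(** Events on one real coordinate, or on two with [box2], written as boxes, so that marginal and
    pair laws can be read off the box law. *)
Definition box1 (q : I * bool) (V : set R) (q' : I * bool) : set R := if q' == q then V else setT.

Lemma box_event1 Z q V : box_event Z (box1 q V) = (fun w => reim q.2 (Z q.1 w)) @^-1` V.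
Proof.
rewrite box_eventE; apply/seteqP; split => w /= H.
  by have := H q; rewrite /box1 eqxx.
by move=> q'; rewrite /box1; case: eqVneq => // ->.
Qed.

Lemma flip_box1 q V : flip q (box1 q V) = box1 q (-%R @^-1` V).
Proof. by apply/funext => q'; rewrite /flip /box1; case: eqP. Qed.

Lemma box_mass1 v q V : box_mass v (box1 q V) = fine (centered_normal (v q.1 / 2) V).
Proof.
rewrite /box_mass /CN_mass (bigD1 q.1)//= big1 ?mulr1.
  case: q => i [] /=; rewrite /box1 !xpair_eqE eqxx /= centered_normalT.
    by rewrite mul1r.
  by rewrite mulr1.
move=> i iq; rewrite /box1; case: q iq => k b /= ik.
by rewrite !xpair_eqE (negPf ik)/= centered_normalT mulr1.
Qed.

Definition box2 (q1 : I * bool) (U : set R) (q2 : I * bool) (V : set R) (q : I * bool) : set R :=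
  if q == q1 then U else if q == q2 then V else setT.

Lemma box_event2 Z q1 U q2 V : q1 != q2 -> box_event Z (box2 q1 U q2 V) =
  (fun w => reim q1.2 (Z q1.1 w)) @^-1` U `&` (fun w => reim q2.2 (Z q2.1 w)) @^-1` V.
Proof.
move=> q12; rewrite box_eventE; apply/seteqP; split => w /=.
  move=> H; split; first by have := H q1; rewrite /box2 eqxx.
  by have := H q2; rewrite /box2 eq_sym (negPf q12) eqxx.
move=> [HU HV] q; rewrite /box2.
by case: eqVneq => [->//|_]; case: eqVneq => [->|].
Qed.

Lemma flip_box2 q1 U q2 V : q1 != q2 ->
  flip q2 (box2 q1 U q2 V) = box2 q1 U q2 (-%R @^-1` V).
Proof.
move=> q12; apply/funext => q; rewrite /flip /box2.
by case: (eqVneq q q2) => [->|//]; rewrite eq_sym (negPf q12).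
Qed.

Lemma measurable_box1 q V : measurable V -> forall q', measurable (box1 q V q').
Proof. by move=> mV q'; rewrite /box1; case: ifP. Qed.

Lemma measurable_box2 q1 U q2 V : measurable U -> measurable V ->
  forall q, measurable (box2 q1 U q2 V q).
Proof. by move=> mU mV q; rewrite /box2; case: ifP => // _; case: ifP. Qed.

Variables (P : probability Om R) (Z : I -> Om -> R[i]) (v : I -> Om -> R).
Hypothesis mZ : forall i, measurable_crv (Z i).
Hypothesis v0 : forall i w, 0 <= v i w.
Hypothesis iv : forall i, rint P (v i).
Hypothesis mlaw : forall W, (forall q, measurable (W q)) ->
  measurable_fun setT (fun w => box_mass (v ^~ w) W).
Hypothesis law : forall W, (forall q, measurable (W q)) ->
  P (box_event Z W) = (\int[P]_w (box_mass (v ^~ w) W)%:E)%E.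

Let X (q : I * bool) w := reim q.2 (Z q.1 w).

Let mX q : measurable_fun setT (X q).
Proof. exact: measurable_crvP. Qed.

(** The integrand of the mixture is invariant for each w. The real coordinates share random
    variances and need not be independent, but the joint law survives a sign change of any one of
    them. *)
Let P_flip q W : (forall q', measurable (W q')) ->
  P (box_event Z (flip q W)) = P (box_event Z W).
Proof.
move=> mW.
have mF q' : measurable (flip q W q').
  by rewrite /flip; case: ifP => // _; exact: measurable_oppr_preimage.
rewrite (law mF) (law mW).
by apply: eq_integral => w _; rewrite box_mass_flip.
Qed.

Let second_moment q : (\int[P]_w (X q w ^+ 2)%:E = \int[P]_w (v q.1 w / 2)%:E)%E.
Proof.
apply: (@mixture_second_moment _ _ _ P (X q) (fun w => v q.1 w / 2)) => //.
- by move=> w; rewrite divr_ge0.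
- move=> U mU; have := mlaw (measurable_box1 q mU).
  by under eq_fun do rewrite box_mass1.
- move=> U mU; rewrite -box_event1 law; last exact: measurable_box1.
  by apply: eq_integral => w _; rewrite box_mass1.
Qed.

Let rint_half i : rint P (fun w => v i w / 2).
Proof. by under eq_fun do rewrite mulrC; exact: rintZ. Qed.

Let rL2_X q : rL2 P (X q).
Proof.
split => //; apply/integrableP; split.
  by apply/measurable_EFinP; exact: measurable_funX.
have [_] := integrableP _ _ _ (rint_half q.1).
under eq_integral do rewrite gee0_abs ?lee_fin ?divr_ge0//.
(* The identity of second moments transfers finiteness from the variance to the square of the
   coordinate. *)
rewrite -second_moment.
by under [X in _ -> (X < _)%E]eq_integral do rewrite gee0_abs ?lee_fin ?sqr_ge0//.
Qed.

Let rexp_sqr q : rexp P (fun w => X q w ^+ 2) = rexp P (v q.1) / 2.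
Proof.
rewrite mulrC -rexpZ// /rexp unlock second_moment.
by congr fine; apply: eq_integral => w _; rewrite mulrC.
Qed.

Let rexp_X q : rexp P (X q) = 0.
Proof.
apply: rexp_sym_eq0 => //; first exact: (rL2_int (rL2_X q)).
move=> V mV; rewrite -!box_event1 -flip_box1 P_flip//.
exact: measurable_box1.
Qed.

(** Flipping the sign of the second coordinate alone preserves the law of the pair, so the product
    has odd expectation. *)
Let rexp_XX q1 q2 : q1 != q2 -> rexp P (fun w => X q1 w * X q2 w) = 0.
Proof.
move=> q12.
apply: (@expectation_odd_eq0 _ _ _ P _ (measurableTypeR R) (X q1) (X q2) id) => //;
  first exact: (mX q1).
  move=> A V mA mV; rewrite -!box_event2// -flip_box2// P_flip//.
  exact: measurable_box2.
exact: rL2_mul.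
Qed.

Lemma mixture_cL2 i : cL2 P (Z i).
Proof. by split; [exact: (rL2_X (i, false))|exact: (rL2_X (i, true))]. Qed.

Lemma mixture_mean i : cexpect P (Z i) = 0.
Proof.
by rewrite cexpectE [rexp _ _](rexp_X (i, false)) [rexp _ _](rexp_X (i, true)).
Qed.

(** On the diagonal, real and imaginary parts contribute half of the variance each; off the diagonal
    only products of distinct real coordinates occur. *)
Lemma mixture_ip i i' : ip P (Z i) (Z i') = (rexp P (v i) *+ (i == i'))%:C.
Proof.
case: (eqVneq i i') => [<-|ii'].
  rewrite mulr1n ipZZ /abs2 rexpD; last 2 first.
  - by have [] := rL2_X (i, false).
  - by have [] := rL2_X (i, true).
  rewrite [rexp _ _](rexp_sqr (i, false)) [X in _ + X](rexp_sqr (i, true)).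
  by rewrite /= -splitr.
rewrite mulr0n.
have qq b b' : (i, b) != (i', b') by rewrite xpair_eqE negb_and ii'.
have iX b b' : rint P (fun w => X (i, b) w * X (i', b') w) by exact: rL2_mul.
apply: complex_ext; rewrite /ip cexpectE /=.
  rewrite (_ : (fun w => _) = (fun w => X (i, false) w * X (i', false) w +
    X (i, true) w * X (i', true) w)); first by rewrite rexpD// !rexp_XX// addr0.
  by apply/funext => w; rewrite cReM cReJ cImJ /X/=; ring.
rewrite (_ : (fun w => _) = (fun w => X (i, true) w * X (i', false) w -
    X (i, false) w * X (i', true) w)); first by rewrite rexpB// !rexp_XX// subr0.
by apply/funext => w; rewrite cImM cReJ cImJ /X/=; ring.
Qed.

End ComplexNormalMixture.

Section CNLaw.
Context {R : realType} {d : measure_display} {Om : measurableType d}.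
Context {I : finType}.
Variables (P : probability Om R) (Z : I -> Om -> R[i]) (v : R).
Hypothesis mZ : forall i, measurable_crv (Z i).
Hypothesis v0 : 0 <= v.
Hypothesis law : CN_law P Z (fun=> v).

(** A deterministic variance is a constant mixture, which makes the mixture results available for
    channels and receiver noise. *)
Let box_law W : (forall q, measurable (W q)) ->
  P (box_event Z W) = (\int[P]_w (box_mass (fun=> v) W)%:E)%E.
Proof.
by move=> mW; rewrite integral_cst//= probability_setT mule1 /box_event law.
Qed.

Lemma CN_law_cL2 i : cL2 P (Z i).
Proof.
by apply: (@mixture_cL2 _ _ _ I P Z (fun _ _ => v)) => // i'; exact: rint_cst.
Qed.

Lemma CN_law_mean i : cexpect P (Z i) = 0.
Proof.
by apply: (@mixture_mean _ _ _ I P Z (fun _ _ => v)) => // i'; exact: rint_cst.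
Qed.

Lemma CN_law_ip i i' : ip P (Z i) (Z i') = (v *+ (i == i'))%:C.
Proof.
by rewrite (@mixture_ip _ _ _ I P Z (fun _ _ => v)) ?rexp_cst// => i''; exact: rint_cst.
Qed.

Lemma CN_law_sym i b (V : set R) : measurable V ->
  P ((fun w => reim b (Z i w)) @^-1` V) = P ((fun w => reim b (Z i w)) @^-1` (-%R @^-1` V)).
Proof.
move=> mV; have E := @box_event1 _ _ _ I Z (i, b).
have m1 := measurable_box1 (i, b) mV.
have m2 := measurable_box1 (i, b) (measurable_oppr_preimage mV).
rewrite -!E (box_law m1) (box_law m2) -flip_box1.
by apply: eq_integral => w _; rewrite box_mass_flip.
Qed.

End CNLaw.

(** * Moments of the uplink model *)

Section Expi.
Context {R : realType}.

Lemma expiD (a b : R) : expi (a + b) = expi a * expi b.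
Proof.
by apply: complex_ext; rewrite ?cReM ?cImM /= ?cosD ?sinD 1?addrC; ring.
Qed.

Lemma expi_conj (a : R) : conjc (expi a) = expi (- a).
Proof. by rewrite /expi cosN sinN. Qed.

Lemma expi0 : expi 0 = 1 :> R[i].
Proof. by rewrite /expi cos0 sin0. Qed.

Lemma abs2_expi (a : R) : abs2 (expi a) = 1.
Proof. by rewrite /abs2 /= cos2Dsin2. Qed.

Lemma meas_expi {d : measure_display} {Om : measurableType d} (G : set (set Om))
    (X : Om -> R) b :
  meas <<s G >> X -> meas <<s G >> (fun w => reim b (expi (X w))).
Proof.
move=> /measP mX; apply: meas_comp; case: b => /=.
  apply: (@measurableT_comp _ _ _ _ _ _ (@sin R)) => //.
  by apply: continuous_measurable_fun; exact: continuous_sin.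
apply: (@measurableT_comp _ _ _ _ _ _ (@cos R)) => //.
by apply: continuous_measurable_fun; exact: continuous_cos.
Qed.

Lemma measurable_expi {d : measure_display} {Om : measurableType d} (X : Om -> R) :
  measurable_fun setT X -> measurable_crv (fun w => expi (X w)).
Proof.
move=> mX; split.
  apply: (@measurableT_comp _ _ _ _ _ _ (@cos R)) => //.
  by apply: continuous_measurable_fun; exact: continuous_cos.
apply: (@measurableT_comp _ _ _ _ _ _ (@sin R)) => //.
by apply: continuous_measurable_fun; exact: continuous_sin.
Qed.

Context {d : measure_display} {Om : measurableType d} (P : probability Om R).

Lemma cL2_expi (X : Om -> R) : measurable_fun setT X -> cL2 P (fun w => expi (X w)).
Proof.
move=> mX; under eq_fun do rewrite -[expi _]mulr1.
apply: cL2M_bounded; [exact: measurable_expi| |exact: cL2_cst].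
by move=> w; rewrite abs2_expi.
Qed.

(** The imaginary part vanishes because sine is odd and the law symmetric; the real part is computed
    for 1 + cos, which is nonnegative. *)
Lemma cexpect_expi_normal (X : Om -> R) (v : R) : 0 <= v -> measurable_fun setT X ->
  (forall U : set R, measurable U -> P (X @^-1` U) = centered_normal v U) ->
  cexpect P (fun w => expi (X w)) = (expR (- (v / 2)))%:C.
Proof.
move=> v0 mX law.
have [ms mc] := cL2_expi mX.
apply: complex_ext; rewrite cexpectE /=; last first.
  apply: rexp_sym_eq0; [by case: mc|exact: (rL2_int mc)|].
  have mS (V : set R) : measurable V -> measurable (@sin R @^-1` V).
    move=> mV; rewrite -[_ @^-1` _]setTI.
    by apply: (continuous_measurable_fun (@continuous_sin R)).
  move=> V mV; rewrite (law _ (mS V mV)).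
  rewrite (law _ (mS _ (measurable_oppr_preimage mV))) -(centered_normalN v0 (mS V mV)).
  by congr centered_normal; apply/seteqP; split => x /=; rewrite sinN.
have i1 : rint P (fun w => cos (X w)) by exact: (rL2_int ms).
have H : rexp P (fun w => 1 + cos (X w)) = 1 + expR (- (v / 2)).
  rewrite /rexp unlock.
  rewrite (@ge0_integral_normal_law _ _ _ P X v (fun x => (1 + cos x)%:E))//.
  - by rewrite cnormal_charfun.
  - apply/measurable_EFinP; apply: measurable_funD => //.
    by apply: continuous_measurable_fun; exact: continuous_cos.
by move: H; rewrite rexpD ?rexp_cst//; [move=> /addrI|exact: rint_cst].
Qed.

End Expi.

Section CondProb.
Context {R : realType} {d : measure_display} {Om : measurableType d}.
Variable P : probability Om R.

(** [cond_independent] acts on explicit versions of conditional probabilities; for events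
    independent of the channels this is the version to feed it. *)
Lemma cond_prob_cst (G : set (set Om)) (E : set Om) :
  (forall F, <<s G >> F -> measurable F) -> measurable E ->
  (forall F, <<s G >> F -> P (F `&` E) = (P F * P E)%E) ->
  cond_prob P <<s G >> E (fun=> fine (P E)).
Proof.
move=> mG mE ind; split; first exact: meas_cst.
- exact: (rint_cst P (fine (P E))).
- move=> F GF; rewrite ind// integral_cst//; last exact: mG.
  by rewrite fineK ?fin_num_measure// muleC.
Qed.

Lemma meas_mul_conj (G : set (set Om)) (Z W : Om -> R[i]) :
  (forall b, meas <<s G >> (fun w => reim b (Z w))) ->
  (forall b, meas <<s G >> (fun w => reim b (W w))) ->
  forall b, meas <<s G >> (fun w => reim b (Z w * conjc (W w))).
Proof.
move=> mZ mW b; apply: meas_comp.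
have mr := measP (mZ false); have mi := measP (mZ true).
have nr := measP (mW false); have ni := measP (mW true).
case: b => /=.
  rewrite (_ : (fun w => _) = (fun w => - (reim false (Z w) * reim true (W w)) +
    reim true (Z w) * reim false (W w))).
    apply: measurable_funD; last exact: measurable_funM.
    by apply: measurableT_comp => //; exact: measurable_funM.
  by apply/funext => w; rewrite cImM cReJ cImJ mulrN.
rewrite (_ : (fun w => _) = (fun w => (reim false (Z w) * reim false (W w)) +
    reim true (Z w) * reim true (W w))).
  by apply: measurable_funD; exact: measurable_funM.
by apply/funext => w; rewrite cReM cReJ cImJ mulrN opprK.
Qed.

End CondProb.

(** * Means and covariances of channels, noises and phases *)

Section ModelMoments.
Context {R : realType} {d : measure_display} {Om : measurableType d}.
Context {L N K B T : nat}.
Variables (P : probability Om R) (S : uplink R Om L N K B).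
Hypothesis hS : uplink_model P T S.
Hypothesis hBT : (B <= T)%N.
Variable j : 'I_L.

Definition chan_entry (l : 'I_L) (k : 'I_K) (n : 'I_N) w := chan S j l k w n 0.
Definition rnoise_entry (i : 'I_B) (n : 'I_N) w := rnoise S j i w n 0.
Definition distortion_entry (i : 'I_B) (n : 'I_N) w := distortion S j i w n 0.

Lemma meas_chan_entry l k n b : meas (sigma_chan S) (fun w => reim b (chan_entry l k n w)).
Proof.
exact: (@meas_sigma_cplx _ _ _ _ (fun (q : 'I_L * 'I_L * 'I_K * 'I_N) w =>
    chan S q.1.1.1 q.1.1.2 q.1.2 w q.2 0) (j, l, k, n) b).
Qed.

Lemma meas_rnoise_entry i n b : meas (sigma_rnoise S) (fun w => reim b (rnoise_entry i n w)).
Proof.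
exact: (@meas_sigma_cplx _ _ _ _ (fun (q : 'I_L * 'I_B * 'I_N) w =>
    rnoise S q.1.1 q.1.2 w q.2 0) (j, i, n) b).
Qed.

Lemma meas_distortion_entry i n b :
  meas (sigma_distortion S) (fun w => reim b (distortion_entry i n w)).
Proof.
exact: (@meas_sigma_cplx _ _ _ _ (fun (q : 'I_L * 'I_B * 'I_N) w =>
    distortion S q.1.1 q.1.2 w q.2 0) (j, i, n) b).
Qed.

Lemma meas_phase n t : (1 <= t <= T)%N -> meas (sigma_phase T S) (phase S j n t).
Proof.
move=> tT; exact: (@meas_sigma_real _ _ _ _ _
  (fun (q : 'I_L * 'I_N * nat) w => phase S q.1.1 q.1.2 q.2 w) (j, n, t)).
Qed.

Lemma sigma_chan_measurable E : sigma_chan S E -> measurable E.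
Proof.
by apply: sigma_cplx_measurable => q; exact: (chan_measurable hS).
Qed.

Lemma sigma_rnoise_measurable E : sigma_rnoise S E -> measurable E.
Proof. by apply: sigma_cplx_measurable => q; exact: (rnoise_measurable hS). Qed.

Lemma measurable_phase n t : (1 <= t <= T)%N -> measurable_fun setT (phase S j n t).
Proof. by have [H _] := phase_wiener hS j n; exact: H. Qed.

Lemma sigma_phase_measurable E : sigma_phase T S E -> measurable E.
Proof.
apply: sigma_real_measurable => -[[j' n] t] /= tT.
by have [H _] := phase_wiener hS j' n; exact: H.
Qed.

Lemma cL2_chan_entry l k n : cL2 P (chan_entry l k n).
Proof.
apply: (CN_law_cL2 _ _ (chan_law hS j l k)); first exact: (chan_measurable hS).
exact/ltW/(lambda_gt0 hS).
Qed.

Lemma mean_chan_entry l k n : cexpect P (chan_entry l k n) = 0.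
Proof.
apply: (CN_law_mean _ _ (chan_law hS j l k)); first exact: (chan_measurable hS).
exact/ltW/(lambda_gt0 hS).
Qed.

Lemma ip_chan_entry l k n l' k' n' : ip P (chan_entry l k n) (chan_entry l' k' n') =
  (lambda S j l k *+ [&& l == l', k == k' & n == n'])%:C.
Proof.
case: (eqVneq (l, k) (l', k')) => [[<- <-]|lk].
  rewrite !eqxx/= (CN_law_ip _ _ (chan_law hS j l k))//; first exact: (chan_measurable hS).
  exact/ltW/(lambda_gt0 hS).
rewrite andbA -xpair_eqE (negPf lk) mulr0n.
rewrite ip_indep; [by rewrite mean_chan_entry mul0r| |exact: cL2_chan_entry..].
move=> b b'.
apply: (@mutually_independent2 _ _ _ P _ _ (j, l, k) (j, l', k') _ _ (chan_indep hS)).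
- by move=> i; exact: sigma_algebraT.
- by move: lk; rewrite !xpair_eqE eqxx.
- exact: (measurable_crvP (chan_measurable hS _ _ _ _)).
- exact: (measurable_crvP (chan_measurable hS _ _ _ _)).
- exact: (@meas_sigma_cplx _ _ _ _ (fun n w => chan S j l k w n 0)).
- exact: (@meas_sigma_cplx _ _ _ _ (fun n w => chan S j l' k' w n 0)).
Qed.

Lemma cL2_rnoise_entry i n : cL2 P (rnoise_entry i n).
Proof.
apply: (CN_law_cL2 _ _ (rnoise_law hS j i)); first exact: (rnoise_measurable hS).
exact/ltW/(noise_power_gt0 hS).
Qed.

Lemma mean_rnoise_entry i n : cexpect P (rnoise_entry i n) = 0.
Proof.
apply: (CN_law_mean _ _ (rnoise_law hS j i)); first exact: (rnoise_measurable hS).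
exact/ltW/(noise_power_gt0 hS).
Qed.

Lemma ip_rnoise_entry i n i' n' : ip P (rnoise_entry i n) (rnoise_entry i' n') =
  (sigma S ^+ 2 * xi S *+ ((i == i') && (n == n')))%:C.
Proof.
case: (eqVneq i i') => [<-|ii'].
  rewrite (CN_law_ip _ _ (rnoise_law hS j i))//; first exact: (rnoise_measurable hS).
  exact/ltW/(noise_power_gt0 hS).
rewrite mulr0n ip_indep; [by rewrite mean_rnoise_entry mul0r| |exact: cL2_rnoise_entry..].
move=> b b'.
refine (mutually_independent2 (rnoise_indep hS (j := j)) _ ii' _ _ _ _).
- by move=> i0; exact: sigma_algebraT.
- exact: (measurable_crvP (rnoise_measurable hS _ _ _)).
- exact: (measurable_crvP (rnoise_measurable hS _ _ _)).
- exact: (@meas_sigma_cplx _ _ _ _ (fun n w => rnoise S j i w n 0)).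
- exact: (@meas_sigma_cplx _ _ _ _ (fun n w => rnoise S j i' w n 0)).
Qed.

(** Induction on [t]: the next innovation is independent of the past of the process, hence of phi(t)
    - phi(s), and contributes one factor exp(-delta/2). *)
Lemma cexpect_phase_incr n t s : (1 <= s)%N -> (s <= t)%N -> (t <= T)%N ->
  cexpect P (fun w => expi (phase S j n t w - phase S j n s w)) =
  (expR (- (delta S / 2) * (t%:R - s%:R)))%:C.
Proof.
move=> s1; elim: t => [|t IH]; first by rewrite leqn0 => /eqP s0; rewrite s0 in s1.
rewrite leq_eqVlt => /predU1P[<- _|].
  rewrite subrr mulr0 expR0; under eq_fun do rewrite subrr expi0.
  by rewrite cexpect_cst.
rewrite ltnS => st tT; have t1 := leq_trans s1 st.
have tT' := ltnW tT.
have [_ /(_ t)] := phase_wiener hS j n; rewrite t1 tT => /(_ isT)[law ind].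
have mt : measurable_fun setT (phase S j n t) by apply: measurable_phase; rewrite t1.
have mt1 : measurable_fun setT (phase S j n t.+1) by apply: measurable_phase.
have ms : measurable_fun setT (phase S j n s).
  by apply: measurable_phase; rewrite s1 (leq_trans st).
pose X w := phase S j n t.+1 w - phase S j n t w.
have mX : measurable_fun setT X by exact: measurable_funB.
pose Y w := phase S j n t w - phase S j n s w.
have mY : measurable_fun setT Y by exact: measurable_funB.
rewrite (_ : (fun w => _) = (fun w => expi (Y w) * expi (X w))); last first.
  by apply/funext => w; rewrite -expiD /X /Y; congr expi; ring.
have indXY b b' : indep_rv P (fun w => reim b (expi (Y w))) (fun w => reim b' (expi (X w))).
  apply: (indep_rv_sigma ind); apply: meas_expi.
    apply: meas_comp; apply: measurable_funB; apply: measP;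
      apply: (@meas_sigma_real _ _ _ _ _ (phase S j n)) => /=.
      by rewrite t1 leqnn.
    by rewrite s1.
  exact: (@meas_sigma_real _ _ _ _ setT (fun _ => X) tt).
rewrite (cexpect_indep indXY _ _).2; [|exact/cL2_int/cL2_expi|exact/cL2_int/cL2_expi].
rewrite IH// (cexpect_expi_normal (delta_ge0 hS) mX law) -rcM -expRD.
by congr (expR _)%:C; rewrite -[t.+1]addn1 natrD; ring.
Qed.

Lemma cexpect_phase n t s : (1 <= s <= T)%N -> (1 <= t <= T)%N ->
  cexpect P (fun w => expi (phase S j n t w - phase S j n s w)) =
  (expR (- (delta S / 2) * `|t%:R - s%:R|))%:C.
Proof.
move=> /andP[s1 sT] /andP[t1 tT].
have [st|/ltnW ts] := leqP s t.
  by rewrite cexpect_phase_incr// ger0_norm// subr_ge0 ler_nat.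
(* For t < s the difference is the opposite of the previous case, so the value is conjugated, and it
   is real. *)
rewrite distrC ger0_norm ?subr_ge0 ?ler_nat// -conjc_real.
rewrite -(cexpect_phase_incr n t1 ts sT) -cexpect_conj.
  by congr cexpect; apply/funext => w; rewrite expi_conj opprB.
by apply/cL2_int/cL2_expi; apply: measurable_funB; apply: measurable_phase; rewrite ?t1 ?s1.
Qed.

Lemma indep_chan_phase : independent2 P (sigma_chan S) (sigma_phase T S).
Proof.
move=> E1 E2 H1 H2.
have HT : sigma_rnoise S setT by exact: sigma_algebraT.
have := sources_indep hS H1 H2 HT.
by rewrite setIT probability_setT mule1.
Qed.

Lemma indep_phase_chan : independent2 P (sigma_phase T S) (sigma_chan S).
Proof. by move=> E1 E2 H1 H2; rewrite setIC indep_chan_phase// muleC. Qed.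

(* The n-th entry of the effective channel h_jlk(t). *)
Definition rotated_chan l k n t w := expi (phase S j n t w) * chan_entry l k n w.

Lemma cL2_rotated_chan l k n t : (1 <= t <= T)%N -> cL2 P (rotated_chan l k n t).
Proof.
move=> tT; apply: cL2M_bounded; [|by move=> w; rewrite abs2_expi|exact: cL2_chan_entry].
exact/measurable_expi/measurable_phase.
Qed.

Lemma mean_rotated_chan l k n t : (1 <= t <= T)%N -> cexpect P (rotated_chan l k n t) = 0.
Proof.
move=> tT; rewrite (cexpect_indep _ _ _).2; first by rewrite mean_chan_entry mulr0.
- move=> b b'; apply: (indep_rv_sigma indep_phase_chan); last exact: meas_chan_entry.
  by apply: meas_expi; exact: meas_phase.
- exact/cL2_int/cL2_expi/measurable_phase.
- exact/cL2_int/cL2_chan_entry.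
Qed.

(** The two phases are grouped into a single difference, independent of the product of channels. At
    distinct antennas that difference mixes two processes, but there the channel factor is 0. *)
Lemma ip_rotated_chan l k n t l' k' n' t' : (1 <= t <= T)%N -> (1 <= t' <= T)%N ->
  ip P (rotated_chan l k n t) (rotated_chan l' k' n' t') =
  (lambda S j l k * expR (- (delta S / 2) * `|t%:R - t'%:R|)
    *+ [&& l == l', k == k' & n == n'])%:C.
Proof.
move=> tT tT'.
rewrite /ip (_ : (fun w => _) = (fun w =>
  expi (phase S j n t w - phase S j n' t' w) *
    (chan_entry l k n w * conjc (chan_entry l' k' n' w)))); last first.
  by apply/funext => w; rewrite /rotated_chan conjcM expi_conj expiD; ring.
rewrite (cexpect_indep _ _ _).2.
- rewrite -/(ip P _ _) ip_chan_entry; case: (eqVneq n n') => [<-|]; last first.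
    by rewrite !andbF !mulr0n mulr0.
  rewrite cexpect_phase//; case: (_ == _); case: (_ == _) => //=; rewrite ?mulr0n ?mulr0// !mulr1n.
  by rewrite -rcM mulrC.
- move=> b b'; apply: (indep_rv_sigma indep_phase_chan).
    by apply: meas_expi; apply: meas_comp; apply: measurable_funB;
      apply: measP; exact: meas_phase.
  by apply: meas_mul_conj => b0; exact: meas_chan_entry.
- by apply/cL2_int/cL2_expi; apply: measurable_funB; exact: measurable_phase.
- by apply: ip_int; exact: cL2_chan_entry.
Qed.

Lemma ip_rotated_chan_rnoise_entry l k n t i n' : (1 <= t <= T)%N ->
  ip P (rotated_chan l k n t) (rnoise_entry i n') = 0.
Proof.
move=> tT; apply: ip_odd => //.
- exact/measurable_expi/measurable_phase.
- by move=> w; rewrite abs2_expi.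
- exact: cL2_chan_entry.
- exact: cL2_rnoise_entry.
move=> b1 b2 b3 U1 U2 V mU1 mU2 mV.
(* For any event on the noise coordinate the probability factorises, so the sign change affects only
   the last factor. *)
have H V' : measurable V' -> P ((fun w => reim b1 (expi (phase S j n t w))) @^-1` U1 `&`
    (fun w => reim b2 (chan_entry l k n w)) @^-1` U2 `&`
    (fun w => reim b3 (rnoise_entry i n' w)) @^-1` V') =
   (P ((fun w => reim b2 (chan_entry l k n w)) @^-1` U2) *
    P ((fun w => reim b1 (expi (phase S j n t w))) @^-1` U1) *
    P ((fun w => reim b3 (rnoise_entry i n' w)) @^-1` V'))%E.
  move=> mV'; rewrite [X in X `&` _]setIC; apply: (sources_indep hS).
  - exact: meas_chan_entry.
  - by apply: meas_expi => //; exact: meas_phase.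
  - exact: meas_rnoise_entry.
rewrite !H//; last exact: measurable_oppr_preimage.
congr (_ * _)%E; apply: (CN_law_sym _ (rnoise_law hS j i)) => //.
exact/ltW/(noise_power_gt0 hS).
Qed.


Let zd (q : 'I_B * 'I_N) w := distortion S j q.1 w q.2 0.
Let vd (q : 'I_B * 'I_N) w := distortion_var S j q.1 q.2 w.

Let mzd q : measurable_crv (zd q).
Proof. exact: (distortion_measurable hS). Qed.

Let vd_ge0 q w : 0 <= vd q w.
Proof.
rewrite mulr_ge0 ?sqr_ge0// sumr_ge0// => l _; rewrite sumr_ge0// => k _.
by rewrite mulr_ge0 ?abs2_ge0.
Qed.

Lemma rexp_abs2_chan_entry l k n : rexp P (fun w => abs2 (chan_entry l k n w)) = lambda S j l k.
Proof. by apply: complexI; rewrite -ipZZ ip_chan_entry !eqxx. Qed.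

Let vd_moment q : rint P (vd q) /\ rexp P (vd q) =
  kappa S ^+ 2 * \sum_(l < L) \sum_(k < K) abs2 (pilot S l k q.1 0) * lambda S j l k.
Proof.
have H l k : rint P (fun w => abs2 (pilot S l k q.1 0) * abs2 (chan_entry l k q.2 w)).
  by apply: rintZ; apply: rint_abs2; exact: cL2_chan_entry.
have H2 l : rint P (fun w => \sum_(k < K) abs2 (pilot S l k q.1 0) * abs2 (chan_entry l k q.2 w)).
  by apply: rint_sum.
have H3 := rint_sum (index_enum 'I_L) (fun l (_ : true) => H2 l).
split; first exact: rintZ.
rewrite /vd /distortion_var rexpZ// rexp_sum//; congr (_ * _); apply: eq_bigr => l _.
rewrite rexp_sum//; apply: eq_bigr => k _; rewrite rexpZ ?rexp_abs2_chan_entry//.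
by apply: rint_abs2; exact: cL2_chan_entry.
Qed.

(** Measurability of the random box mass is contained in the integrability clause of [cond_prob]. *)
Let zd_mlaw (W : ('I_B * 'I_N) * bool -> set R) : (forall q, measurable (W q)) ->
  measurable_fun setT (fun w => box_mass (vd ^~ w) W).
Proof.
move=> mW; have [_ H _] := distortion_law hS j (fun i => mW (i, false)) (fun i => mW (i, true)).
by apply/measurable_EFinP; exact: (measurable_int _ H).
Qed.

(** The conditional law integrated over the whole space, that is, with conditioning event [setT]. *)
Let zd_law (W : ('I_B * 'I_N) * bool -> set R) : (forall q, measurable (W q)) ->
  P (box_event zd W) = (\int[P]_w (box_mass (vd ^~ w) W)%:E)%E.
Proof.
move=> mW; have [_ _ H] := distortion_law hS j (fun i => mW (i, false)) (fun i => mW (i, true)).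
have HT : sigma_chan S setT by exact: sigma_algebraT.
by have := H setT HT; rewrite setTI.
Qed.

Lemma cL2_distortion_entry i n : cL2 P (distortion_entry i n).
Proof.
apply: (mixture_cL2 mzd vd_ge0 _ zd_mlaw zd_law (i, n)) => q.
by have [] := vd_moment q.
Qed.

Lemma mean_distortion_entry i n : cexpect P (distortion_entry i n) = 0.
Proof.
apply: (mixture_mean mzd vd_ge0 _ zd_mlaw zd_law (i, n)) => q.
by have [] := vd_moment q.
Qed.

Lemma ip_distortion_entry i n i' n' :
  ip P (distortion_entry i n) (distortion_entry i' n') =
  (kappa S ^+ 2 * (\sum_(l < L) \sum_(k < K) abs2 (pilot S l k i 0) * lambda S j l k)
    *+ ((i == i') && (n == n')))%:C.
Proof.
rewrite -xpair_eqE -[kappa S ^+ 2 * _](vd_moment (i, n)).2.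
apply: (mixture_ip mzd vd_ge0 _ zd_mlaw zd_law (i, n) (i', n')) => q.
by have [] := vd_moment q.
Qed.

Let box_event_distortion W : (forall q, measurable (W q)) ->
  sigma_distortion S (box_event zd W).
Proof.
move=> mW.
have -> : box_event zd W = \bigcap_(q in [set: ('I_B * 'I_N) * bool])
    (fun w => reim q.2 (zd q.1 w)) @^-1` (W q).
  by rewrite box_eventE; apply/seteqP; split => w H q; [move=> _; exact: H|exact: H].
apply: (@fin_bigcap_measurable _ (g_sigma_algebraType _)) => //.
by move=> q _; apply: meas_distortion_entry.
Qed.

(** Given the channels, the box has conditional probability [box_mass] and the phase and noise event
    a constant one. Conditional independence makes their product a version for the intersection,
    which is integrated over [G]. *)
Lemma distortion_event G Ep Er W : sigma_chan S G -> sigma_phase T S Ep ->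
  sigma_rnoise S Er -> (forall q, measurable (W q)) ->
  P (G `&` (box_event zd W `&` (Ep `&` Er))) =
  (\int[P]_(w in G) (box_mass (vd ^~ w) W * fine (P (Ep `&` Er)))%:E)%E.
Proof.
move=> HG Hp Hr mW.
have mEE : measurable (Ep `&` Er).
  by apply: measurableI; [exact: sigma_phase_measurable|exact: sigma_rnoise_measurable].
have PE : P (Ep `&` Er) = (P Ep * P Er)%E.
  have HT : sigma_chan S setT by exact: sigma_algebraT.
  have := sources_indep hS HT Hp Hr.
  by rewrite setTI probability_setT mul1e.
have c2 : cond_prob P (sigma_chan S) (Ep `&` Er) (fun=> fine (P (Ep `&` Er))).
  apply: cond_prob_cst => // [F|F HF]; first exact: sigma_chan_measurable.
  by rewrite setIA (sources_indep hS)// PE muleA.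
have c1 := distortion_law hS j (fun i => mW (i, false)) (fun i => mW (i, true)).
have HE2 : <<s sigma_phase T S `|` sigma_rnoise S >> (Ep `&` Er).
  by apply: sigma_algebraI; apply: sub_sigma_algebra; [left|right].
have [_ _] := distortion_cond_indep hS (box_event_distortion mW) HE2 c1 c2.
exact.
Qed.

(** The distortion depends on the channels, yet flipping one of its real coordinates leaves
    [box_mass] unchanged for each w, hence also the joint probability with any events on channels,
    phases and receiver noise. *)
Lemma distortion_sym G Ep Er i n b V : sigma_chan S G -> sigma_phase T S Ep ->
  sigma_rnoise S Er -> measurable V ->
  P (Ep `&` G `&` Er `&` (fun w => reim b (distortion_entry i n w)) @^-1` V) =
  P (Ep `&` G `&` Er `&` (fun w => reim b (distortion_entry i n w)) @^-1` (-%R @^-1` V)).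
Proof.
move=> HG Hp Hr mV; have E := @box_event1 _ _ _ _ zd ((i, n), b).
have rearr F : Ep `&` G `&` Er `&` F = G `&` (F `&` (Ep `&` Er)).
  by rewrite [Ep `&` G]setIC -!setIA [F `&` _]setIC -setIA.
have m1 := measurable_box1 ((i, n), b) mV.
have m2 := measurable_box1 ((i, n), b) (measurable_oppr_preimage mV).
rewrite !rearr -!E (distortion_event HG Hp Hr m1) (distortion_event HG Hp Hr m2).
by rewrite -flip_box1; apply: eq_integral => w _; rewrite box_mass_flip.
Qed.

Lemma ip_rotated_chan_distortion_entry l k n t i n' : (1 <= t <= T)%N ->
  ip P (rotated_chan l k n t) (distortion_entry i n') = 0.
Proof.
move=> tT; apply: ip_odd => //.
- exact/measurable_expi/measurable_phase.
- by move=> w; rewrite abs2_expi.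
- exact: cL2_chan_entry.
- exact: cL2_distortion_entry.
move=> b1 b2 b3 U1 U2 V mU1 mU2 mV.
have := @distortion_sym ((fun w => reim b2 (chan_entry l k n w)) @^-1` U2)
  ((fun w => reim b1 (expi (phase S j n t w))) @^-1` U1) setT i n' b3 V.
rewrite !setIT; apply => //.
- exact: meas_chan_entry.
- by apply: meas_expi => //; exact: meas_phase.
- exact: sigma_algebraT.
Qed.

Lemma ip_rnoise_entry_distortion_entry i n i' n' :
  ip P (rnoise_entry i n) (distortion_entry i' n') = 0.
Proof.
(* The constant 1 takes the place of the bounded factor in [ip_odd]. *)
rewrite (_ : rnoise_entry i n = fun w => 1 * rnoise_entry i n w); last first.
  by apply/funext => w; rewrite mul1r.
apply: ip_odd.
- by split; exact: measurable_cst.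
- by move=> w; rewrite /abs2 /= expr1n expr0n addr0.
- exact: cL2_rnoise_entry.
- exact: cL2_distortion_entry.
move=> b1 b2 b3 U1 U2 V mU1 mU2 mV.
(* The event on the constant 1 fills the phase slot, and the channel slot is the whole space. *)
have := @distortion_sym setT ((fun=> reim b1 1) @^-1` U1)
  ((fun w => reim b2 (rnoise_entry i n w)) @^-1` U2) i' n' b3 V.
rewrite setIT; apply => //.
- exact: sigma_algebraT.
- exact: meas_cst.
- exact: meas_rnoise_entry.
Qed.

End ModelMoments.

(** * Covariances of the received pilots *)

Lemma sum_mxtens (V : nmodType) m n (F : 'I_m -> 'I_n -> V) :
  \sum_(c < m * n) F (mxtens_unindex c).1 (mxtens_unindex c).2 = \sum_i \sum_j F i j.
Proof.
rewrite pair_bigA (reindex (@mxtens_index m n)); last first.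
  by exists (@mxtens_unindex m n) => c _; rewrite ?mxtens_indexK ?mxtens_unindexK.
by apply: eq_bigr => p _; rewrite mxtens_indexK.
Qed.

Lemma error_outerE (R : realType) (d : measure_display) (Om : measurableType d) m
    (g ghat : Om -> 'cV[R[i]]_m) w a b :
  error_outer g ghat w a b = (g w - ghat w) a 0 * conjc ((g w - ghat w) b 0).
Proof.
by rewrite /error_outer mxE big_ord1; congr (_ * _); rewrite /ctransmx mxE mxE.
Qed.

Section Received.
Context {R : realType} {d : measure_display} {Om : measurableType d}.
Context {L N K B T : nat}.
Variables (P : probability Om R) (S : uplink R Om L N K B).
Hypothesis hS : uplink_model P T S.
Hypothesis hBT : (B <= T)%N.
Variable j : 'I_L.

Let pil (p : 'I_L * 'I_K) (i : 'I_B) := pilot S p.1 p.2 i 0.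
Let u (p : 'I_L * 'I_K) n t := rotated_chan S j p.1 p.2 n t.
Let y i n w := received S j i w n 0.

Lemma receivedE i n w : received S j i w n 0 =
  \sum_p pil p i * u p n i.+1 w + distortion_entry S j i n w + rnoise_entry S j i n w.
Proof.
rewrite /received mxE [X in X + _]mxE /phase_mx mul_diag_mx !mxE.
rewrite -/(distortion_entry S j i n w) -/(rnoise_entry S j i n w); congr (_ + _ + _).
rewrite summxE mulr_sumr -(pair_bigA _ (fun l k => pil (l, k) i * u (l, k) n i.+1 w)).
apply: eq_bigr => l _; rewrite mxE mulr_sumr; apply: eq_bigr => k _.
by rewrite !mxE /u /rotated_chan /chan_entry /pil /= mulrA mulrC.
Qed.

Let pilot_use (i : 'I_B) : (1 <= i.+1 <= T)%N.
Proof. by rewrite /= (leq_trans (ltn_ord i)). Qed.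

Let sig i n w := \sum_p pil p i * u p n i.+1 w.

Let cL2_upil p n (i : 'I_B) : cL2 P (u p n i.+1).
Proof. exact: (cL2_rotated_chan hS _ _ _ _ (pilot_use i)). Qed.

Let cL2_sig i n : cL2 P (sig i n).
Proof. by apply: cL2_sum => p _; apply: cL2Z. Qed.

Let yE i n : y i n = fun w => sig i n w + distortion_entry S j i n w + rnoise_entry S j i n w.
Proof. by apply/funext => w; rewrite /y receivedE. Qed.

Let c2ups i n := cL2_distortion_entry hS j i n.
Let c2eta i n := cL2_rnoise_entry hS j i n.

Lemma cL2_received i n : cL2 P (fun w => received S j i w n 0).
Proof.
by rewrite -/(y i n) yE; apply: cL2D; [apply: cL2D|].
Qed.

Lemma mean_received i n : cexpect P (fun w => received S j i w n 0) = 0.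
Proof.
rewrite -/(y i n) yE !cexpectD; last 4 first.
- exact/cL2_int.
- exact/cL2_int.
- by apply: cintegrableD; exact: cL2_int.
- exact/cL2_int.
rewrite (mean_distortion_entry hS) (mean_rnoise_entry hS) !addr0 cexpect_sum; last first.
  by move=> p _; exact/cL2_int/cL2Z.
apply: big1 => p _; rewrite cexpectZ; last exact: cL2_int.
by rewrite (mean_rotated_chan hS _ _ _ _ (pilot_use i)) mulr0.
Qed.

Let ip_sig_l i n W : cL2 P W ->
  ip P (sig i n) W = \sum_p pil p i * ip P (u p n i.+1) W.
Proof.
move=> W2; rewrite ip_suml//; last by move=> p _; exact: cL2Z.
by apply: eq_bigr => p _; rewrite ipZl.
Qed.

Let ip_sig_distortion_entry i n i' n' : ip P (sig i n) (distortion_entry S j i' n') = 0.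
Proof.
rewrite ip_sig_l//; apply: big1 => p _.
by rewrite (ip_rotated_chan_distortion_entry hS _ _ _ _ _ _ (pilot_use i)) mulr0.
Qed.

Let ip_sig_rnoise_entry i n i' n' : ip P (sig i n) (rnoise_entry S j i' n') = 0.
Proof.
rewrite ip_sig_l//; apply: big1 => p _.
by rewrite (ip_rotated_chan_rnoise_entry hS _ _ _ _ _ _ (pilot_use i)) mulr0.
Qed.

(** Of all terms in the received sample only the one of the same user at the same antenna is
    correlated with the channel. *)
Lemma ip_rotated_chan_received l k n t i n' : (1 <= t <= T)%N ->
  ip P (rotated_chan S j l k n t) (fun w => received S j i w n' 0) =
  ((lambda S j l k)%:C * conjc (pilot S l k i 0) *
    (expR (- (delta S / 2) * `|t%:R - i.+1%:R|))%:C) *+ (n == n').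
Proof.
move=> tT; have u2 := cL2_rotated_chan hS j l k n tT.
rewrite -/(y i n') yE !ipDr//; last exact: cL2D.
rewrite (ip_rotated_chan_distortion_entry hS _ _ _ _ _ _ tT).
rewrite (ip_rotated_chan_rnoise_entry hS _ _ _ _ _ _ tT) !addr0.
rewrite ip_sumr//; last by move=> p _; exact: cL2Z.
rewrite (bigD1 (l, k))//= big1 ?addr0.
  rewrite ipZr// (ip_rotated_chan hS _ _ _ _ _ _ _ tT (pilot_use i)) !eqxx/= /pil/=.
  by case: (n == n'); rewrite ?mulr1n ?mulr0n ?mulr0// rcM; ring.
move=> [l' k'] lk; rewrite ipZr// (ip_rotated_chan hS _ _ _ _ _ _ _ tT (pilot_use i)) /=.
by rewrite andbA -xpair_eqE eq_sym (negPf lk) mulr0n mulr0.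
Qed.

Let ip_sig_sig i n i' n' : ip P (sig i n) (sig i' n') =
  (\sum_p pil p i * conjc (pil p i') * (lambda S j p.1 p.2 *
     expR (- (delta S / 2) * `|i%:R - i'%:R|))%:C) *+ (n == n').
Proof.
rewrite ip_sig_l// -sumrMnl; apply: eq_bigr => p _.
rewrite ip_sumr//; last by move=> p' _; exact: cL2Z.
rewrite (bigD1 p)//= big1 ?addr0.
  rewrite ipZr// (ip_rotated_chan hS _ _ _ _ _ _ _ (pilot_use i) (pilot_use i')) !eqxx/=.
  (* Indices start at 0 and channel uses at 1; the shift cancels in differences. *)
  have -> : i.+1%:R - i'.+1%:R = i%:R - i'%:R :> R.
    by rewrite -[i.+1]addn1 -[i'.+1]addn1 !natrD; ring.
  by case: (n == n'); rewrite ?mulr1n ?mulr0n ?mulr0// mulrA.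
move=> p' pp'; rewrite ipZr// (ip_rotated_chan hS _ _ _ _ _ _ _ (pilot_use i) (pilot_use i')).
case: p p' pp' => [l k] [l' k'] /= pp'.
by rewrite andbA -xpair_eqE eq_sym (negPf pp') mulr0n mulr0.
Qed.

(** This says that the covariance of psi_j is Psi_j tensor I_N. Of the diagonal factor 1 + kappa^2,
    the 1 comes from the signal and kappa^2 from the distortion, which is white across channel
    uses. *)
Lemma ip_received i n i' n' :
  ip P (fun w => received S j i w n 0) (fun w => received S j i' w n' 0) =
  Psi_mx S j i i' *+ (n == n').
Proof.
have su a b : cL2 P (fun w => sig a b w + distortion_entry S j a b w) by exact: cL2D.
have sue a b : cL2 P (fun w => sig a b w + distortion_entry S j a b w + rnoise_entry S j a b w).
  by apply: cL2D.
have e1 : ip P (distortion_entry S j i n) (sig i' n') = 0.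
  by rewrite ipC// ip_sig_distortion_entry conjc0.
have e2 : ip P (rnoise_entry S j i n) (sig i' n') = 0.
  by rewrite ipC// ip_sig_rnoise_entry conjc0.
have e3 : ip P (distortion_entry S j i n) (rnoise_entry S j i' n') = 0.
  by rewrite ipC// (ip_rnoise_entry_distortion_entry hS) conjc0.
rewrite -/(y i n) -/(y i' n') !yE !(ipDl, ipDr)//.
rewrite ip_sig_distortion_entry ip_sig_rnoise_entry e1 e2 e3.
rewrite (ip_rnoise_entry_distortion_entry hS) !addr0 !add0r.
rewrite ip_sig_sig (ip_distortion_entry hS) (ip_rnoise_entry hS).
have -> : Psi_mx S j i i' = \sum_p ((lambda S j p.1 p.2)%:C * X_mx S p.1 p.2 i i') +
    (sigma S ^+ 2 * xi S *+ (i == i'))%:C.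
  rewrite /Psi_mx mxE [X in _ + X]mxE; congr (_ + _); last by case: (i == i').
  rewrite summxE -(pair_bigA _ (fun l k => (lambda S j l k)%:C * X_mx S l k i i')).
  by apply: eq_bigr => l _; rewrite summxE; apply: eq_bigr => k _; rewrite mxE.
case: (n == n'); last by rewrite !andbF !mulr0n !addr0.
rewrite !andbT !mulr1n; congr (_ + _); case: (eqVneq i i') => [<-|ii'].
  rewrite /= mulr1n subrr normr0 mulr0 expR0.
  rewrite (pair_bigA _ (fun l k => abs2 (pilot S l k i 0) * lambda S j l k)).
  rewrite rcM rc_sum mulr_sumr -big_split; apply: eq_bigr => -[l k] _ /=.
  rewrite mxE eqxx mulr1 mulc_conj /pil /= -!rcM -rcD; congr _%:C; ring.
rewrite /= mulr0n addr0; apply: eq_bigr => p _.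
by rewrite mxE (negPf ii') rcM /pil; ring.
Qed.

(** Cutting [D] into one row of length B per antenna turns the second moment into a sum over
    antennas of forms of Psi_j, each of them nonnegative and definite. *)
Lemma definite_pilot_obs (D : 'rV[R[i]]_(B * N)) :
  rexp P (fun w => abs2 ((D *m pilot_obs S j w) 0 0)) = 0 -> D = 0.
Proof.
pose Dq n i := D 0 (mxtens_index (i, n)).
have DE : (fun w => (D *m pilot_obs S j w) 0 0) =
    (fun w => \sum_n \sum_i Dq n i * received S j i w n 0).
  apply/funext => w; rewrite mxE exchange_big -sum_mxtens.
  apply: eq_bigr => c _; rewrite mxE /Dq.
  by rewrite -surjective_pairing mxtens_unindexK.
move=> D0; have : ip P (fun w => (D *m pilot_obs S j w) 0 0)
    (fun w => (D *m pilot_obs S j w) 0 0) = 0 by rewrite ipZZ D0.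
rewrite DE => H.
have y2 := cL2_received.
have Dy2 n : cL2 P (fun w => \sum_i Dq n i * received S j i w n 0).
  by apply: cL2_sum => i _; exact: cL2Z.
have sq : \sum_n qform (Psi_mx S j) (Dq n) = 0.
  rewrite -[RHS]H ip_suml//; last by apply: cL2_sum => n _; exact: Dy2.
  apply: eq_bigr => n _; rewrite ip_sumr// (bigD1 n)//= big1 ?addr0.
    rewrite ip_suml//; last by move=> i _; exact: cL2Z.
    apply: eq_bigr => i _; rewrite ipZl// ip_sumr//; last by move=> i' _; exact: cL2Z.
    rewrite mulr_sumr; apply: eq_bigr => i' _.
    by rewrite ipZr// ip_received eqxx mulr1n; ring.
  move=> n' n'n; rewrite ip_suml//; last by move=> i _; exact: cL2Z.
  apply: big1 => i _; rewrite ipZl// ip_sumr//; last by move=> i' _; exact: cL2Z.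
  rewrite big1 ?mulr0// => i' _.
  by rewrite ipZr// ip_received eq_sym (negPf n'n) mulr0n mulr0.
have q0 n : 0 <= qform (Psi_mx S j) (Dq n).
  apply: le_trans (qform_Psi_mx_ge hS j (Dq n)).
  rewrite ler0c mulr_ge0 ?(ltW (noise_power_gt0 hS))// sumr_ge0// => i _.
  exact: abs2_ge0.
have qn n : qform (Psi_mx S j) (Dq n) = 0.
  move/eqP: sq; rewrite psumr_eq0//.
  by move=> /allP/(_ n (mem_index_enum n))/eqP.
apply/rowP => c; rewrite mxE.
have := qform_Psi_mx_eq0 hS (qn (mxtens_unindex c).2) (mxtens_unindex c).1.
by rewrite /Dq -surjective_pairing mxtens_unindexK.
Qed.

Variables (l : 'I_L) (k : 'I_K) (t : nat).
Hypothesis hBt : (B <= t)%N.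

Definition filter_row : 'rV[R[i]]_B :=
  (lambda S j l k)%:C *: (ctransmx (pilot S l k) *m D_delta S t *m invmx (Psi_mx S j)).

(** Covariance of h_n(t) with the pilot sample [i] at the same antenna. No absolute value is needed
    in the exponent since i + 1 <= B <= t. *)
Definition cross_cov (i : 'I_B) : R[i] :=
  (lambda S j l k)%:C * conjc (pilot S l k i 0) *
    (expR (- (delta S / 2) * (t%:R - i.+1%:R)))%:C.

(** The normal equations on one antenna; invertibility of Psi_j cancels its inverse. *)
Lemma filter_row_Psi i : \sum_i' filter_row 0 i' * Psi_mx S j i' i = cross_cov i.
Proof.
have : filter_row *m Psi_mx S j = (lambda S j l k)%:C *: (ctransmx (pilot S l k) *m D_delta S t).
  by rewrite /filter_row -scalemxAl mulmxKV// (Psi_mx_unit hS).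
move/matrixP/(_ 0 i); rewrite mxE => ->.
by rewrite mxE /D_delta mul_mx_diag !mxE /cross_cov mulrA.
Qed.

Lemma LMMSE_filterE w n : (LMMSE_filter S j l k t *m pilot_obs S j w) n 0 =
  \sum_i filter_row 0 i * received S j i w n 0.
Proof.
have FE c : LMMSE_filter S j l k t n c =
    filter_row 0 (mxtens_unindex c).1 * (n == (mxtens_unindex c).2)%:R.
  rewrite /LMMSE_filter castmxE cast_ord_id mxE [X in _ * X]mxE.
  (* A row index of the product 1 * N splits into quotient 0 and remainder [n]. *)
  set q := mxtens_unindex (cast_ord _ n).
  have -> : q.1 = 0 by exact: ord1.
  by have -> : q.2 = n by apply: val_inj; rewrite /= modn_small.
rewrite mxE.
transitivity (\sum_i \sum_n' filter_row 0 i * (n == n')%:R * received S j i w n' 0).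
  by rewrite -sum_mxtens; apply: eq_bigr => c _; rewrite FE [pilot_obs _ _ _ _ _]mxE.
apply: eq_bigr => i _; rewrite (bigD1 n)//= big1 ?addr0 ?eqxx ?mulr1// => n' nn'.
by rewrite eq_sym (negPf nn') mulr0 mul0r.
Qed.

Lemma eff_chanE w n : eff_chan S j l k t w n 0 = rotated_chan S j l k n t w.
Proof. by rewrite /eff_chan /phase_mx mul_diag_mx !mxE. Qed.

Hypothesis tT : (1 <= t <= T)%N.

Let err n w := (eff_chan S j l k t w - LMMSE_filter S j l k t *m pilot_obs S j w) n 0.

Let errE n :
  err n = fun w => rotated_chan S j l k n t w - \sum_i filter_row 0 i * received S j i w n 0.
Proof. by apply/funext => w; rewrite /err mxE [X in _ + X]mxE LMMSE_filterE eff_chanE. Qed.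

Let u2 n := cL2_rotated_chan hS j l k n tT.

Let est2 n : cL2 P (fun w => \sum_i filter_row 0 i * received S j i w n 0).
Proof. by apply: cL2_sum => i _; apply: cL2Z; exact: cL2_received. Qed.

Lemma cL2_error n : cL2 P (err n).
Proof. by rewrite errE; exact: cL2B. Qed.

Lemma ip_rotated_chan_received_pilot n i n' :
  ip P (rotated_chan S j l k n t) (fun w => received S j i w n' 0) = cross_cov i *+ (n == n').
Proof.
rewrite ip_rotated_chan_received// ger0_norm// subr_ge0 ler_nat.
exact: leq_trans (ltn_ord i) hBt.
Qed.

Lemma ip_error_l n W : cL2 P W -> ip P (err n) W = ip P (rotated_chan S j l k n t) W -
  \sum_i filter_row 0 i * ip P (fun w => received S j i w n 0) W.
Proof.
move=> W2; rewrite errE.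
rewrite (_ : (fun w => _) = (fun w => rotated_chan S j l k n t w +
   (-1) * \sum_i filter_row 0 i * received S j i w n 0)); last first.
  by apply/funext => w; rewrite mulN1r.
rewrite ipDl//; last exact: cL2Z.
rewrite ipZl// mulN1r ip_suml//; last by move=> i _; apply: cL2Z; exact: cL2_received.
by congr (_ - _); apply: eq_bigr => i _; rewrite ipZl//; exact: cL2_received.
Qed.

(** The observations at antenna n' select column n' of Psi_j tensor I_N, where the normal equations
    apply. *)
Lemma error_orth n i n' : ip P (err n) (fun w => received S j i w n' 0) = 0.
Proof.
rewrite ip_error_l; last exact: cL2_received.
rewrite ip_rotated_chan_received_pilot -filter_row_Psi.
under [X in _ - X]eq_bigr do rewrite ip_received mulrnAr.
by rewrite sumrMnl subrr.
Qed.

(** The estimate is a combination of observations, to which the error is orthogonal, so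
    E[e_n e_n'^*] = E[e_n h_n'^*]; this is the channel variance minus the filter applied to the
    conjugated cross-covariances. *)
Lemma ip_error n n' : ip P (err n) (err n') =
  error_cov S j l k t n n'.
Proof.
have -> : ip P (err n) (err n') = ip P (err n) (rotated_chan S j l k n' t).
  have e2 := cL2_error n.
  rewrite [err n']errE.
  rewrite (_ : (fun w => _) = (fun w => rotated_chan S j l k n' t w +
     (-1) * \sum_i filter_row 0 i * received S j i w n' 0)); last first.
    by apply/funext => w; rewrite mulN1r.
  rewrite ipDr//; last exact: cL2Z.
  rewrite ipZr// ip_sumr//; last by move=> i _; apply: cL2Z; exact: cL2_received.
  rewrite big1 ?mulr0 ?addr0// => i _.
  by rewrite ipZr ?error_orth ?mulr0//; exact: cL2_received.
rewrite ip_error_l// (ip_rotated_chan hS _ _ _ _ _ _ _ tT tT).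
rewrite !eqxx subrr normr0 mulr0 expR0 mulr1 /=.
under eq_bigr => i _.
  rewrite ipC//; last exact: cL2_received.
  rewrite ip_rotated_chan_received_pilot eq_sym.
  over.
rewrite /error_cov mxE; case: (n == n'); last first.
  by rewrite !mulr0n big1 ?subr0// => i _; rewrite mulr0n conjc0 mulr0.
rewrite !mulr1n mulrBr mulr1; congr (_ - _).
rewrite -mulmxA mxE !mulr_sumr; apply: eq_bigr => i _.
rewrite /filter_row mxE /cross_cov !conjcM conjcK !conjc_real.
have -> : (ctransmx (D_delta S t) *m pilot S l k) i 0 =
    (expR (- (delta S / 2) * (t%:R - i.+1%:R)))%:C * pilot S l k i 0.
  rewrite /ctransmx /D_delta map_diag_mx tr_diag_mx mul_diag_mx !mxE.
  by congr (_ * _); exact: conjc_real.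
ring.
Qed.

Lemma LMMSE_characterization (g : Om -> 'cV[R[i]]_N) :
  is_LMMSE P (eff_chan S j l k t) (pilot_obs S j) g <->
  g = fun w => LMMSE_filter S j l k t *m pilot_obs S j w.
Proof.
have obsE c : (fun w => pilot_obs S j w c 0) =
    (fun w => received S j (mxtens_unindex c).1 w (mxtens_unindex c).2 0).
  by apply/funext => w; rewrite mxE.
have effE n : (fun w => eff_chan S j l k t w n 0) = rotated_chan S j l k n t.
  by apply/funext => w; rewrite eff_chanE.
apply: is_LMMSE_orthogonal.
- by move=> n; rewrite effE.
- by move=> c; rewrite obsE; exact: cL2_received.
- by move=> n c; rewrite obsE; exact: error_orth.
- exact: definite_pilot_obs.
- by apply/matrixP => n c; rewrite (ord1 c) !mxE effE (mean_rotated_chan hS _ _ _ _ tT).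
- by apply/matrixP => c c'; rewrite (ord1 c') !mxE obsE mean_received.
Qed.

End Received.

Theorem theorem1 (R : realType) (d : measure_display) (Om : measurableType d)
    (P : probability Om R) (L N K B T : nat)
    (hL : (1 <= L)%N) (hKB : (K <= B)%N) (hBT : (B <= T)%N)
    (S : uplink R Om L N K B) (hS : uplink_model P T S)
    (j l : 'I_L) (k : 'I_K) (t : nat) (hBt : (B <= t)%N) (htT : (t <= T)%N) :
  let h := eff_chan S j l k t in
  let psi := pilot_obs S j in
  let hhat := fun w : Om => LMMSE_filter S j l k t *m psi w in
  let C := mx_expect P (error_outer h hhat) in
  [/\ Psi_mx S j \in unitmx,
      forall g : Om -> 'cV[R[i]]_N, is_LMMSE P h psi g <-> g = hhat,
      mx_integrable P (error_outer h hhat),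
      C = error_cov S j l k t &
      (mse P h hhat \is a fin_num) /\ (fine (mse P h hhat))%:C = \tr C].
Proof.
move=> h psi hhat C.
(* The existence of the index [k] forces K >= 1, so 1 <= K <= B <= t. *)
have tT : (1 <= t <= T)%N.
  by rewrite htT andbT (leq_trans _ hBt)// (leq_trans _ hKB)// (leq_ltn_trans _ (ltn_ord k)).
have oE a b : (fun w => error_outer h hhat w a b) =
    (fun w => (h w - hhat w) a 0 * conjc ((h w - hhat w) b 0)).
  by apply/funext => w; rewrite error_outerE.
have CE : C = error_cov S j l k t.
  apply/matrixP => a b; rewrite /C [LHS]mxE oE.
  exact: (ip_error hS hBT j l k hBt tT a b).
have e2 := cL2_error hS hBT j l k tT.
have mE : mse P h hhat = (\sum_(a < N) rexp P (fun w => abs2 ((h w - hhat w) a 0)))%:E.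
  apply: mseE => [a|c].
    rewrite (_ : (fun w => _) = rotated_chan S j l k a t); last first.
      by apply/funext => w; rewrite /h eff_chanE.
    exact: (cL2_rotated_chan hS).
  rewrite (_ : (fun w => _) = (fun w => received S j (mxtens_unindex c).1 w
    (mxtens_unindex c).2 0)); last by apply/funext => w; rewrite mxE.
  exact: (cL2_received hS hBT).
split.
- exact: (Psi_mx_unit hS).
- by move=> g; apply: (LMMSE_characterization hS hBT j l k hBt tT).
- by move=> a b; rewrite oE; exact: ip_int.
- exact: CE.
- rewrite mE; split => //=.
  (* Each diagonal entry of C is the inner product of an error coordinate with itself, that is, its
     expected squared modulus. *)
  rewrite rc_sum /mxtrace; apply: eq_bigr => a _.
  by rewrite /C [RHS]mxE oE -ipZZ.
Qed.
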